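(* There exist absolute constants $c>0$ and $n_0$ such that for every integer $n\ge n_0$ there is a real number $\varepsilon_n$ with $$|\varepsilon_n|\le \exp\bigl(-c\sqrt{\log n\,\log\log n}\bigr)$$ and $$C(n) = n!\left(\prod_{p\text{ prime}}\frac{(p-1)^{2(1-1/p)}}{p\,(p-2)^{(1-2/p)}} + \varepsilon_n\right)^n,$$ where $C(n)$ is the number of coprime permutations of $\{1,\ldots,n\}$, the product is over all primes $p$, and the factor at $p=2$ is taken to be $1/2$.
   Context: $[n]=\{1,\ldots,n\}$. A permutation $\sigma\colon[n]\to[n]$ is called coprime if $\gcd(m,\sigma(m))=1$ for every $m\in[n]$. $C(n)$ denotes the number of coprime permutations $\sigma\colon[n]\to[n]$. Logarithms are natural. *)

(* Defs.v *)
From HB Require Import structures.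
From mathcomp Require Import all_boot all_order all_algebra all_fingroup.
From mathcomp Require Import all_classical all_reals all_analysis.
From mathcomp Require Import ring lra.
Set Implicit Arguments.
Unset Strict Implicit.
Unset Printing Implicit Defensive.
Import Order.TTheory GRing.Theory Num.Theory.
Import numFieldNormedType.Exports.
Local Open Scope classical_set_scope.
Local Open Scope ring_scope.

(* The ordinal i : 'I_n stands for the integer i.+1 of {1, ..., n}. *)
Definition coprime_perm (n : nat) (s : 'S_n) : bool :=
  [forall i : 'I_n, coprime i.+1 (s i).+1].

Definition coprime_perm_count (n : nat) : nat :=
  #|[set s : 'S_n | coprime_perm s]%SET|.

Definition euler_factor (R : realType) (p : nat) : R :=
  if p == 2%N then 2^-1
  else (p%:R - 1) `^ (2 * (1 - p%:R^-1)) /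
       (p%:R * (p%:R - 2) `^ (1 - 2 / p%:R)).

Definition euler_partial (R : realType) (N : nat) : R :=
  \prod_(0 <= p < N | prime p) euler_factor R p.

Definition euler_product (R : realType) : R := limn (@euler_partial R).

Lemma euler_factor_ge0 (R : realType) (p : nat) : 0 <= euler_factor R p.
Proof.
rewrite /euler_factor; case: ifP => _; first by rewrite invr_ge0.
by rewrite divr_ge0 ?mulr_ge0 ?powR_ge0 ?ler0n.
Qed.

Lemma euler_factor_le1 (R : realType) (p : nat) :
  prime p -> euler_factor R p <= 1.
Proof.
move=> pp; rewrite /euler_factor; case: eqVneq => [_|p2].
  by rewrite invf_le1 ?ler1n.
have : (2 < p)%N by rewrite ltn_neqAle eq_sym p2 prime_gt1.
rewrite -(ltr_nat R); set P : R := p%:R => P2.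
have P0 : 0 < P by lra.
have a0 : 0 < P - 1 by lra.
have b0 : 0 < P - 2 by lra.
have d0 : 0 < P * (P - 2) `^ (1 - 2 / P) by rewrite mulr_gt0 ?powR_gt0.
rewrite ler_pdivrMr // mul1r -ler_ln ?posrE ?powR_gt0 //.
rewrite lnM ?posrE ?powR_gt0 // !ln_powR.
have h1 : ln (P - 1) - ln P <= - P^-1.
  rewrite -ln_div ?posrE // mulrBl divff ?gt_eqF // mul1r le_ln1Dx //.
  by rewrite ltrN2 invf_lt1 //; lra.
have h2 : ln (P - 1) - ln (P - 2) <= (P - 2)^-1.
  rewrite -ln_div ?posrE //.
  have -> : (P - 1) / (P - 2) = 1 + (P - 2)^-1.
    rewrite -[X in _ = X + _](@divff _ (P - 2)) ?gt_eqF // -[X in _ = _ + X]mul1r.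
    by rewrite -mulrDl; congr (_ / _); lra.
  by rewrite le_ln1Dx // (lt_trans (ltrN10 R)) ?invr_gt0.
rewrite -(ler_pM2l P0).
have PV : P * P^-1 = 1 by rewrite divff ?gt_eqF.
have k1 : P * (ln (P - 1) - ln P) <= - 1.
  by apply: le_trans (_ : P * - P^-1 <= _); rewrite ?ler_pM2l // mulrN PV.
have k2 : (P - 2) * (ln (P - 1) - ln (P - 2)) <= 1.
  by rewrite -[leRHS](@divff _ (P - 2)) ?gt_eqF // ler_pM2l.
have P0' : P != 0 by rewrite gt_eqF.
move: (ln P) (ln (P - 1)) (ln (P - 2)) {h1 h2} k1 k2 => A B C k1 k2.
have -> : P * (2 * (1 - P^-1) * B) = 2 * (P - 1) * B by field.
have -> : P * (A + (1 - 2 / P) * C) = P * A + (P - 2) * C by field.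
lra.
Qed.

Lemma is_cvg_euler_partial (R : realType) : cvgn (@euler_partial R).
Proof.
have ge0 N : 0 <= euler_partial R N.
  by rewrite prodr_ge0 // => p _; exact: euler_factor_ge0.
apply: nonincreasing_is_cvgn.
  apply/nonincreasing_seqP => N; rewrite /euler_partial big_mkcond /=.
  rewrite big_nat_recr //= -big_mkcond /=; case: ifP => [pN|_]; last by rewrite mulr1.
  by rewrite ler_piMr ?euler_factor_le1 //; exact: ge0.
by exists 0 => _ [N _ <-]; exact: ge0.
Qed.

(* Main.v *)
Require Import Defs.
From HB Require Import structures.
From mathcomp Require Import all_boot all_order all_algebra all_fingroup.
From mathcomp Require Import all_classical all_reals all_analysis.
From mathcomp Require Import complex.
From mathcomp Require Import ring lra zify.
Import Order.TTheory GRing.Theory Num.Theory.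
Set Implicit Arguments.
Unset Strict Implicit.
Unset Printing Implicit Defensive.
Local Open Scope ring_scope.

(** C(n) is the permanent of the 0/1 coprimality matrix.  For odd primes p <= z
    put a_p = (p-1)/(p-2), let h(i) be the product of the a_p over the p dividing
    i, and scale the entries (i,j) of opposite parity by K h(i) h(j) for the right
    constant K.  A sieve shows that all rows of the scaled matrix sum to
    1 + O(n^(-delta)), since the multiplicative weight involved is summable away
    from the primes dividing i.  The n-th root of the total scaling factor is the
    Euler product truncated at z, up to a factor 1 + o(1), so it suffices to show
    that the permanent of the scaled matrix is exp(-n + O(n^(1-delta))).

    Upper bound: Schrijver's proof of the Bregman-Minc inequality, run for real
    matrices with small entries.  Lower bound: solving a Laplace equation on the
    weighted coprimality graph makes the scaled matrix exactly doubly stochastic;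
    then Gurvits' capacity argument gives permanent at least exp(-n).  With
    z = q^4 and q about n^(1/12) all errors are O(1/q), which is stronger than
    the claim. *)

(** * Permanents and stability *)

(** The numbers a_p and K come from a two-class model at one prime: a fraction 1/p of the indices is
    divisible by p, and two such indices are never paired. If divisible indices get weight a, the
    two kinds of rows sum to a(1 - 1/p) and a/p + 1 - 1/p. Equality forces a = (p-1)/(p-2), and the
    reciprocal of the common value, p(p-2)/(p-1)^2, is the factor of K at p. At p = 2 the weight
    would be infinite, since even integers can only be paired with odd ones; hence the restriction
    to opposite parity. For odd n exactly one odd-odd pair is unavoidable, so parity needs separate
    care in each of the two bounds. The truncation z is a compromise: the sieve error in row i grows
    like z^2 2^omega(i) / n, while primes above z dividing i stay uncompensated and cost 2^omega(i)
    / z. *)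

Lemma deriv_prod (T : comNzRingType) (I : finType) (F : I -> {poly T}) :
  (\prod_i F i)^`() = \sum_i (F i)^`() * \prod_(j | j != i) F j.
Proof.
have key (s : seq I) : uniq s -> (\prod_(i <- s) F i)^`() =
    \sum_(i <- s) (F i)^`() * \prod_(j <- s | j != i) F j.
  elim: s => [|a s IH] /=; first by rewrite !big_nil derivC.
  case/andP=> aNs us; rewrite !big_cons derivM IH // eqxx /=.
  congr (_ * _ + _).
    rewrite big_seq_cond [in RHS]big_seq_cond; apply: eq_bigl => j.
    by case: (boolP (j \in s)) => //= js; rewrite (memPn aNs).
  rewrite mulr_sumr big_seq [in RHS]big_seq; apply: eq_bigr => i si.
  by rewrite big_cons eq_sym (memPn aNs) //= mulrCA.
by rewrite -[index_enum I]enumT in key *; exact/key/enum_uniq.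
Qed.

Definition permanent (T : comNzRingType) (n : nat) (M : 'I_n -> 'I_n -> T) : T :=
  \sum_(s : 'S_n) \prod_i M i (s i).

Lemma eq_permanent (T : comNzRingType) n (M N : 'I_n -> 'I_n -> T) :
  (forall i j, M i j = N i j) -> permanent M = permanent N.
Proof. by move=> MN; apply: eq_bigr => s _; apply: eq_bigr. Qed.

Lemma rmorph_permanent (T U : comNzRingType) (f : {rmorphism T -> U}) n
    (M : 'I_n -> 'I_n -> T) :
  f (permanent M) = permanent (fun i j => f (M i j)).
Proof. by rewrite rmorph_sum; apply: eq_bigr => s _; rewrite rmorph_prod. Qed.

Lemma permanent_colE (T : comNzRingType) n (M : 'I_n -> 'I_n -> T) :
  permanent M = \sum_(s : 'S_n) \prod_j M (s j) j.
Proof.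
rewrite /permanent (reindex_inj invg_inj) /=; apply: eq_bigr => s _.
by rewrite (reindex_inj (@perm_inj _ s)) /=; apply: eq_bigr => j _; rewrite permK.
Qed.

Lemma permanent_col_perm (T : comNzRingType) n (M : 'I_n -> 'I_n -> T) (t : 'S_n) :
  permanent (fun i j => M i (t j)) = permanent M.
Proof.
rewrite /permanent [RHS](reindex_inj (mulIg t)) /=; apply: eq_bigr => s _.
by apply: eq_bigr => i _; rewrite permM.
Qed.

Lemma deriv_permanent (T : comNzRingType) n (M : 'I_n -> 'I_n -> {poly T}) :
  (permanent M)^`() =
  \sum_l permanent (fun i j => if j == l then (M i j)^`() else M i j).
Proof.
rewrite permanent_colE raddf_sum /=.
under [RHS]eq_bigr do rewrite permanent_colE.
rewrite exchange_big /=; apply: eq_bigr => s _.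
rewrite deriv_prod; apply: eq_bigr => l _.
rewrite [RHS](bigD1 l) //= eqxx; congr (_ * _).
by apply: eq_bigr => j /negPf->.
Qed.

Lemma permanent_scale_row (T : comNzRingType) n (a : 'I_n -> T) (M : 'I_n -> 'I_n -> T) :
  permanent (fun i j => a i * M i j) = (\prod_i a i) * permanent M.
Proof.
by rewrite /permanent big_distrr; apply: eq_bigr => s _; rewrite big_split.
Qed.

Lemma permanent_scale_col (T : comNzRingType) n (a : 'I_n -> T) (M : 'I_n -> 'I_n -> T) :
  permanent (fun i j => M i j * a j) = permanent M * \prod_i a i.
Proof.
rewrite !permanent_colE big_distrl; apply: eq_bigr => s _.
by rewrite big_split.
Qed.

Lemma permanent_ge0 (R : numDomainType) n (M : 'I_n -> 'I_n -> R) :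
  (forall i j, 0 <= M i j) -> 0 <= permanent M.
Proof. by move=> M0; apply: sumr_ge0 => s _; apply: prodr_ge0. Qed.

Lemma le_permanent (R : numDomainType) n (M N : 'I_n -> 'I_n -> R) :
  (forall i j, 0 <= M i j <= N i j) -> permanent M <= permanent N.
Proof. by move=> MN; apply: ler_sum => s _; apply: ler_prod. Qed.

(* [colpoly B y k] is the permanent of [B] with its first [k] columns replaced
   by [y], i.e. [k!] times the derivative of [\prod_i y_i] along the last
   [n - k] columns of [B]. *)
Definition colpoly (T : comNzRingType) n (B : 'I_n -> 'I_n -> T) (k : nat)
    (y : 'I_n -> T) : T :=
  permanent (fun i j => if (j < k)%N then y i else B i j).

Lemma colpoly_scale (T : comNzRingType) n (B : 'I_n -> 'I_n -> T) k y a :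
  (k <= n)%N -> colpoly B k (fun i => a * y i) = a ^+ k * colpoly B k y.
Proof.
move=> kn; rewrite mulrC.
rewrite -[k in a ^+ k]card_ord -prodr_const.
have -> : \prod_(i in 'I_k) a = \prod_(j < n) (if (j < k)%N then a else 1).
  by rewrite -big_mkcond (big_ord_widen n (fun=> a)).
rewrite -permanent_scale_col; apply: eq_permanent => i j.
by case: ifP; rewrite ?mulr1 // mulrC.
Qed.

Lemma colpoly0 (T : comNzRingType) n (B : 'I_n -> 'I_n -> T) y :
  colpoly B 0 y = permanent B.
Proof. by []. Qed.

Lemma colpoly_full (T : comNzRingType) n (B : 'I_n -> 'I_n -> T) y :
  colpoly B n y = n`!%:R * \prod_i y i.
Proof.
rewrite /colpoly /permanent.
transitivity (\sum_(s : 'S_n) \prod_i y i).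
  by apply: eq_bigr => s _; apply: eq_bigr => i _; rewrite ltn_ord.
by rewrite sumr_const card_Sn mulr_natl.
Qed.

Definition linepoly (T : comNzRingType) n (B : 'I_n -> 'I_n -> T) (k : nat)
    (u v : 'I_n -> T) : {poly T} :=
  colpoly (fun i j => (B i j)%:P) k (fun i => (u i)%:P + (v i)%:P * 'X).

Lemma horner_linepoly (T : comNzRingType) n (B : 'I_n -> 'I_n -> T) k u v t :
  (linepoly B k u v).[t] = colpoly B k (fun i => u i + v i * t).
Proof.
rewrite -horner_evalE rmorph_permanent; apply: eq_permanent => i j.
by case: ifP => _ /=; rewrite horner_evalE !hornerE.
Qed.

Lemma map_linepoly (T U : comNzRingType) (f : {rmorphism T -> U}) n
    (B : 'I_n -> 'I_n -> T) k u v :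
  map_poly f (linepoly B k u v) =
  linepoly (fun i j => f (B i j)) k (fun i => f (u i)) (fun i => f (v i)).
Proof.
rewrite /linepoly rmorph_permanent; apply: eq_permanent => i j /=.
by case: ifP => _; rewrite /= ?rmorphD ?rmorphM /= ?map_polyX !map_polyC.
Qed.

(** By multilinearity each of the first [k.+1] columns contributes one term, and swapping that
    column with column [k] turns it into [colpoly B k u]; later columns are constant. Lowering [k]
    is thus a directional derivative along a column of [B]. *)
Lemma deriv_linepoly (T : comNzRingType) n (B : 'I_n -> 'I_n -> T) (k : 'I_n) u :
  (linepoly B k.+1 u (B^~ k))^`().[0] = k.+1%:R * colpoly B k u.
Proof.
rewrite deriv_permanent -horner_evalE raddf_sum /=.
rewrite (eq_bigr (fun l : 'I_n => if (l < k.+1)%N then colpoly B k u else 0)).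
  rewrite -big_mkcond /= -(big_ord_widen n (fun=> colpoly B k u)) ?ltn_ord //.
  by rewrite sumr_const card_ord mulr_natl.
move=> l _; rewrite rmorph_permanent; case: ifP => [lk|/negbT lk]; last first.
  rewrite /permanent big1 // => s _; rewrite (bigD1 (s^-1 l)%g) //= permKV eqxx.
  by rewrite (negPf lk) derivC rmorph0 mul0r.
rewrite /colpoly -(permanent_col_perm _ (tperm l k)); apply: eq_permanent => i j.
case: tpermP => [->|->|/eqP jl /eqP jk].
- case: eqVneq => [<-|kl].
    by rewrite ltnSn ltnn derivD derivM !derivC derivX /= horner_evalE !hornerE.
  by rewrite ltnSn ltn_neqAle -ltnS lk andbT eq_sym kl /= horner_evalE !hornerE.
- by rewrite eqxx lk ltnn derivD derivM !derivC derivX /= horner_evalE !hornerE.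
- rewrite (negPf jl) ltnS leq_eqVlt val_eqE (negPf jk) orFb.
  by case: ifP => _; rewrite /= horner_evalE !hornerE.
Qed.

Lemma poly_nat_roots (R : numDomainType) (p : {poly R}) :
  (forall m : nat, p.[m.+1%:R] = 0) -> p = 0.
Proof.
move=> p0; apply/eqP; apply: contraT => pN0.
have := @max_poly_roots _ p [seq m.+1%:R | m <- iota 0 (size p)] pN0.
rewrite size_map size_iota ltnn => -> //.
  by apply/allP => _ /mapP[m _ ->]; rewrite rootE p0.
rewrite map_inj_uniq ?iota_uniq // => a b /eqP.
by rewrite eqr_nat => /eqP[].
Qed.

(** * Half-plane stability and real-rootedness *)

Lemma Re_oppV_gt0 (R : rcfType) (r : R[i]) :
  complex.Re r < 0 -> 0 < complex.Re (- r^-1).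
Proof.
case: r => a b /= a0; rewrite oppr_gt0 pmulr_llt0 // invr_gt0.
by rewrite ltr_wpDr ?sqr_ge0 // exprn_even_gt0 //= lt_eqF.
Qed.

Lemma logderiv_left (R : rcfType) (rs : seq R[i]) :
  {in rs, forall r, complex.Re r < 0} ->
  exists s : R[i],
    [/\ (\prod_(r <- rs) ('X - r%:P))^`().[0] = s * (\prod_(r <- rs) ('X - r%:P)).[0],
        0 <= complex.Re s & rs != [::] -> 0 < complex.Re s].
Proof.
elim: rs => [_|r rs IH rneg].
  by exists 0; rewrite big_nil derivC mul0r horner0.
have [|s [es s0 _]] := IH; first by move=> x xs; rewrite rneg // in_cons xs orbT.
have r0 : complex.Re r < 0 by rewrite rneg // mem_head.
have rN0 : r != 0 by apply: contraTneq r0 => ->; rewrite ltxx.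
have Re1 := Re_oppV_gt0 r0.
exists (- r^-1 + s); rewrite raddfD /=; split.
- rewrite big_cons derivM derivXsubC mul1r hornerD !hornerM es hornerXsubC sub0r.
  by field.
- by rewrite addr_ge0 // ltW.
- by rewrite ltr_wpDr.
Qed.

Lemma Re_realM (R : rcfType) (a : R) (z : R[i]) :
  complex.Re (a%:C%C * z) = a * complex.Re z.
Proof. by case: z => x y /=; rewrite mul0r subr0. Qed.

Definition stable_colpoly (R : rcfType) n (B : 'I_n -> 'I_n -> R) (k : nat) :=
  forall y : 'I_n -> R[i], (forall i, 0 < complex.Re (y i)) ->
    colpoly (fun i j => (B i j)%:C%C) k y != 0.

(* Gauss-Lucas: the logarithmic derivative of a polynomial whose roots have
   negative real part has positive real part at the origin. *)
Lemma stable_colpolyS (R : rcfType) n (B : 'I_n -> 'I_n -> R) (k : 'I_n) :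
  (forall i j, 0 < B i j) -> stable_colpoly B k.+1 -> stable_colpoly B k.
Proof.
move=> B0 st y y0; set BC := fun i j => _.
pose P := linepoly BC k.+1 y (BC^~ k).
have PN0 t : 0 <= complex.Re t -> P.[t] != 0.
  move=> t0; rewrite horner_linepoly; apply: st => i.
  by rewrite raddfD /= Re_realM ltr_wpDr // mulr_ge0 // ltW.
have [rs Prs] := closed_field_poly_normal P.
have P0 : P != 0 by apply: contraNneq (PN0 0 (lexx _)) => ->; rewrite horner0.
have leadN0 : lead_coef P != 0 by rewrite lead_coef_eq0.
have rsneg : {in rs, forall r, complex.Re r < 0}.
  move=> r rrs; rewrite ltNge; apply: contraTN rrs => /PN0.
  by rewrite Prs hornerZ mulf_eq0 (negPf leadN0) /= -rootE root_prod_XsubC.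
(* Without roots [P] would be a constant [c]. By homogeneity the polynomial with [y] and column [k]
   exchanged is then [c] times the power [k.+1] of the variable. It vanishes at 0, so [colpoly]
   vanishes at the positive column [k], against stability. *)
have rsN0 : rs != [::].
  apply: contraTneq isT => rs0; move: Prs; rewrite rs0 big_nil.
  set c := lead_coef P => Pc; exfalso.
  have Q0 : linepoly BC k.+1 (BC^~ k) y - c%:P * 'X^(k.+1) = 0.
    apply: poly_nat_roots => m; rewrite hornerD hornerN !hornerE horner_linepoly.
    have mN0 : (m.+1%:R : R[i]) != 0 by rewrite pnatr_eq0.
    rewrite (_ : colpoly _ _ _ = colpoly BC k.+1
        (fun i => m.+1%:R * (y i + BC i k * m.+1%:R^-1))); last first.
      apply: eq_permanent => i j; case: ifP => // _.
      by rewrite mulrDr mulrCA divff // mulr1 addrC mulrC.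
    rewrite colpoly_scale // -horner_linepoly -/P Pc hornerZ hornerC mulr1.
    by rewrite mulrC subrr.
  have /negP[] := st (BC^~ k) (fun i => B0 i k).
  have := congr1 (horner^~ 0) Q0; rewrite horner0 hornerD hornerN.
  rewrite horner_linepoly !hornerE expr0n mulr0 subr0 => Q00.
  apply/eqP; rewrite -[RHS]Q00.
  by apply: eq_permanent => i j; rewrite mulr0 addr0.
have [s [es _ /(_ rsN0) s0]] := logderiv_left rsneg.
have := deriv_linepoly BC k y; rewrite -/P Prs derivZ hornerZ es mulrCA -hornerZ.
rewrite -Prs => sP; have : s * P.[0] != 0.
  rewrite mulf_neq0 ?PN0 //.
  by apply: contraTneq s0 => ->; rewrite ltxx.
by rewrite sP; apply: contraNneq => ->; rewrite mulr0.
Qed.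

Lemma stable_colpolyP (R : rcfType) n (B : 'I_n -> 'I_n -> R) (k : nat) :
  (forall i j, 0 < B i j) -> (k <= n)%N -> stable_colpoly B k.
Proof.
move=> B0 kn; rewrite -(subKn kn); elim: (n - k)%N (leq_subr k n) => [_|d IH dn].
  rewrite subn0 => y y0; rewrite colpoly_full mulf_neq0 ?pnatr_eq0 -?lt0n ?fact_gt0 //.
  by apply/prodf_neq0 => i _; apply: contraTneq (y0 i) => ->; rewrite ltxx.
have dn' : (n - d.+1 < n)%N by rewrite ltn_subrL (leq_trans _ dn).
apply: (@stable_colpolyS _ _ _ (Ordinal dn')) => //=.
by rewrite subnSK //; apply: IH; exact: ltnW.
Qed.

(** A point off the closed negative real axis and the point 1 lie in a common open half-plane
    bounded by a line through the origin; [w] rotates it onto the right half-plane. *)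
Lemma rotation (R : rcfType) (t : R[i]) :
  ~ (t = (complex.Re t)%:C%C /\ complex.Re t <= 0) ->
  exists w : R[i], 0 < complex.Re w /\ 0 < complex.Re (w * t).
Proof.
case: t => a b /= tP.
set N := Num.sqrt (a ^+ 2 + b ^+ 2).
have ab0 : 0 <= a ^+ 2 + b ^+ 2 by rewrite addr_ge0 ?sqr_ge0.
have N2 : N ^+ 2 = a ^+ 2 + b ^+ 2 by rewrite sqr_sqrtr.
have N0 : 0 <= N by rewrite sqrtr_ge0.
have Na : 0 < N + a.
  have [a0|a0] := ltP 0 a; first by rewrite ltr_wpDl.
  have b0 : 0 < b ^+ 2.
    rewrite lt_def sqr_ge0 andbT sqrf_eq0; apply/eqP => b0.
    by apply: tP; rewrite b0.
  have : (- a) ^+ 2 < N ^+ 2 by rewrite N2 sqrrN ltrDl.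
  by rewrite ltr_pXn2r ?nnegrE // ?oppr_ge0 //; lra.
(* This is |t| plus the conjugate of [t], so that w t = |t| (t + |t|). *)
exists (Complex (N + a) (- b)) => /=; split => //.
have -> : (N + a) * a - - b * b = N * (N + a) + (a ^+ 2 + b ^+ 2 - N ^+ 2) by ring.
rewrite N2 subrr addr0 mulr_gt0 // lt_def N0 andbT.
apply/eqP => NN; apply: tP.
have : a ^+ 2 + b ^+ 2 = 0 by rewrite -N2 NN expr0n.
move/eqP; rewrite paddr_eq0 ?sqr_ge0 // !sqrf_eq0 => /andP[/eqP-> /eqP->].
by split.
Qed.

(** Any other root [t] could be rotated together with 1 into the right half-plane; by homogeneity
    [colpoly] would vanish at the rotated vector [w (u + v t)], which stability forbids. *)
Lemma linepoly_real_rooted (R : rcfType) n (B : 'I_n -> 'I_n -> R) k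
    (u v : 'I_n -> R) (t : R[i]) :
  (forall i j, 0 < B i j) -> (k <= n)%N ->
  (forall i, 0 < u i) -> (forall i, 0 < v i) ->
  root (map_poly (real_complex R) (linepoly B k u v)) t ->
  t = (complex.Re t)%:C%C /\ complex.Re t <= 0.
Proof.
move=> B0 kn u0 v0; rewrite rootE map_linepoly horner_linepoly => tr.
apply: contrapT => /rotation[w [w0 wt0]].
have : colpoly (fun i j => (B i j)%:C%C) k
    (fun i => w * ((u i)%:C%C + (v i)%:C%C * t)) != 0.
  apply: stable_colpolyP => // i; rewrite mulrDr raddfD /= mulrC Re_realM.
  by rewrite mulrCA Re_realM addr_gt0 ?mulr_gt0.
by rewrite colpoly_scale // (eqP tr) mulr0 eqxx.
Qed.

(** A root [q < 0] gives the factor [- q * (1 + t * - q^-1)], at most [- q * expR (t * - q^-1)], and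
    the exponents add up to the logarithmic derivative [s] at 0. A root at 0 is excluded by [0 <
    p.[0]]. *)
Lemma real_rooted_exp_bound (R : realType) (p : {poly R}) :
  (forall t : R[i], root (map_poly (real_complex R) p) t ->
     t = (complex.Re t)%:C%C /\ complex.Re t <= 0) ->
  0 < p.[0] ->
  exists s : R, [/\ 0 <= s, p^`().[0] = s * p.[0] &
    forall t, 0 <= t -> p.[t] <= p.[0] * expR (t * s)].
Proof.
move=> pr p0; set pC := map_poly _ p in pr.
have pN0 : p != 0 by apply: contraTneq p0 => ->; rewrite horner0 ltxx.
have pCN0 : pC != 0 by rewrite map_poly_eq0.
have [rs prs] := closed_field_poly_normal pC.
have [qs qrs qneg] : exists2 qs : seq R, rs = [seq (real_complex R) q | q <- qs] &
    {in qs, forall q, q < 0}.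
  have rsr : {in rs, forall r, r = (complex.Re r)%:C%C /\ complex.Re r < 0}.
    move=> r rrs; have rr : root pC r.
      by rewrite prs rootZ ?lead_coef_eq0 // root_prod_XsubC.
    have [e le0] := pr _ rr; split => //; rewrite lt_neqAle le0 andbT.
    apply: contraTneq p0 => r0; move: rr; rewrite e r0.
    rewrite rootE (_ : 0%:C%C = (real_complex R) 0) // horner_map.
    by rewrite fmorph_eq0 => /eqP->; rewrite ltxx.
  exists [seq complex.Re r | r <- rs].
    by rewrite -map_comp -[LHS]map_id; apply/eq_in_map => r /rsr[].
  by move=> _ /mapP[r /rsr[_ ? ->]].
have pE : p = lead_coef p *: \prod_(q <- qs) ('X - q%:P).
  apply: (map_inj_poly (f := real_complex R)) => //; first exact: complexI.
  rewrite -/pC prs qrs linearZ /= lead_coef_map; congr (_ *: _).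
  by rewrite -(prod_map_poly _ _ predT) /=.
have key : exists s : R, [/\ 0 <= s,
    (\prod_(q <- qs) ('X - q%:P))^`().[0] = s * (\prod_(q <- qs) ('X - q%:P)).[0],
    0 < (\prod_(q <- qs) ('X - q%:P)).[0] &
    forall t, 0 <= t -> 0 <= (\prod_(q <- qs) ('X - q%:P)).[t] <=
      (\prod_(q <- qs) ('X - q%:P)).[0] * expR (t * s)].
  elim: qs qneg {pE qrs} => [_|q qs IH qneg].
    exists 0; rewrite big_nil derivC mul0r horner0 !hornerE; split => // t t0.
    by rewrite mulr0 expR0 hornerE mulr1 ler01 lexx.
  have [|s [s0 es Q0 Qt]] := IH.
    by move=> x xs; rewrite qneg // in_cons xs orbT.
  have q0 : q < 0 by rewrite qneg // mem_head.
  have qN0 : q != 0 by rewrite lt_eqF.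
  set Q := \prod_(_ <- _) _ in es Q0 Qt.
  have iq0 : 0 < - q^-1 by rewrite oppr_gt0 invr_lt0.
  exists (- q^-1 + s); rewrite big_cons -/Q; split.
  - by rewrite addr_ge0 // ltW.
  - rewrite derivM derivXsubC mul1r hornerD !hornerM es hornerXsubC sub0r.
    by field.
  - by rewrite hornerM hornerXsubC sub0r mulr_gt0 // oppr_gt0.
  - move=> t t0; have /andP[Qt0 Qt1] := Qt _ t0; rewrite !hornerM !hornerXsubC sub0r.
    have tq : 0 <= t - q by rewrite subr_ge0 (le_trans (ltW q0)).
    rewrite mulr_ge0 //= mulrDr expRD.
    rewrite [leRHS](_ : _ = (- q * expR (t * - q^-1)) * (Q.[0] * expR (t * s))); last by ring.
    apply: ler_pM => //.
    rewrite (_ : t - q = - q * (1 + t * - q^-1)); last by field.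
    by rewrite ler_wpM2l ?oppr_ge0 ?(ltW q0) // expR_ge1Dx.
have [s [s0 es Q0 Qt]] := key.
exists s; split => //.
  by rewrite pE derivZ !hornerZ es mulrCA.
have l0 : 0 < lead_coef p by move: p0; rewrite {1}pE hornerZ pmulr_lgt0.
move=> t t0; rewrite pE !hornerZ -mulrA ler_pM2l //.
by have /andP[] := Qt t t0.
Qed.

(** * Capacity bounds *)

Lemma permanent_gt0 (R : numDomainType) n (M : 'I_n -> 'I_n -> R) :
  (forall i j, 0 < M i j) -> 0 < permanent M.
Proof.
move=> M0; rewrite /permanent (bigD1 1%g) //= ltr_wpDr //.
  by apply: sumr_ge0 => s _; apply: prodr_ge0 => i _; exact: ltW.
by apply: prodr_gt0.
Qed.

(** Gurvits' induction, run from [k = n] downwards. On the line through [u] along column [k],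
    real-rootedness bounds the value at [1 / s] by [e] times the value at 0, so removing one
    variable costs a factor [e]. The factorial matches the normalisation of [colpoly]. *)
Lemma colpoly_capacity (R : realType) n (B : 'I_n -> 'I_n -> R) (C : R) (k : nat) :
  0 <= C -> (forall i j, 0 < B i j) ->
  (forall x : 'I_n -> R, (forall j, 0 < x j) ->
     C * \prod_j x j <= \prod_i \sum_j B i j * x j) ->
  (0 < k <= n)%N ->
  forall x : 'I_n -> R, (forall j, 0 < x j) ->
    C * k`!%:R * expR (- (n - k)%:R) * \prod_(j < n | (j < k)%N) x j <=
    colpoly B k (fun i => \sum_(j < n | (j < k)%N) B i j * x j).
Proof.
move=> C0 B0 cap /andP[k0 kn].
have [d dE] : exists d, d = (n - k)%N by exists (n - k)%N.
elim: d k k0 kn dE => [|d IH] k k0 kn dE x x0.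
  have -> : k = n by lia.
  rewrite subnn oppr0 expR0 mulr1 colpoly_full -mulrA mulrCA ler_pM2l ?ltr0n ?fact_gt0 //.
  have -> : \prod_(j < n | (j < n)%N) x j = \prod_j x j.
    by apply: eq_bigl => j; rewrite ltn_ord.
  rewrite [leRHS](eq_bigr (fun i => \sum_j B i j * x j)) ?cap // => i _.
  by apply: eq_bigl => j; rewrite ltn_ord.
have kn' : (k < n)%N by lia.
pose kk := Ordinal kn'.
pose u i := \sum_(j < n | (j < k)%N) B i j * x j.
have u0 i : 0 < u i.
  have n0 : (0 < n)%N by lia.
  rewrite /u (bigD1 (Ordinal n0)) //= ltr_wpDr ?mulr_gt0 //.
  by apply: sumr_ge0 => j _; rewrite mulr_ge0 // ltW.
pose R1 := linepoly B k.+1 u (B^~ kk).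
have R10 : 0 < R1.[0].
  rewrite horner_linepoly; apply: permanent_gt0 => i j; case: ifP => // _.
  by rewrite mulr0 addr0.
have [s [s0 es Rt]] : exists s : R, [/\ 0 <= s, R1^`().[0] = s * R1.[0] &
    forall t, 0 <= t -> R1.[t] <= R1.[0] * expR (t * s)].
  by apply: real_rooted_exp_bound => // t; apply: linepoly_real_rooted.
have Dk : R1^`().[0] = k.+1%:R * colpoly B k u := deriv_linepoly B kk u.
have Pk0 : 0 < colpoly B k u by apply: permanent_gt0 => i j; case: ifP.
have s_gt0 : 0 < s.
  rewrite lt_def s0 andbT; apply: contraTneq Pk0 => s00.
  have := Dk; rewrite es s00 mul0r => /esym/eqP.
  by rewrite mulf_eq0 pnatr_eq0 /= => /eqP->; rewrite ltxx.
(* The new variable is the point [t = 1 / s] that minimises [expR (t * s) / t]. *)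
pose x' j := if j == kk then s^-1 else x j.
have x'0 j : 0 < x' j by rewrite /x'; case: ifP; rewrite ?invr_gt0.
have split_prod : \prod_(j < n | (j < k.+1)%N) x' j =
    s^-1 * \prod_(j < n | (j < k)%N) x j.
  rewrite (bigD1 kk) //= /x' eqxx; congr (_ * _); apply: eq_big => [j|j].
    by rewrite ltnS -(inj_eq val_inj) /= andbC -ltn_neqAle.
  by move=> /andP[_ /negPf->].
have split_sum i : \sum_(j < n | (j < k.+1)%N) B i j * x' j = u i + B i kk * s^-1.
  rewrite (bigD1 kk) //= /x' eqxx addrC; congr (_ + _); apply: eq_big => [j|j].
    by rewrite ltnS -(inj_eq val_inj) /= andbC -ltn_neqAle.
  by move=> /andP[_ /negPf->].
have := IH k.+1 (ltn0Sn _) kn' _ x' x'0; rewrite split_prod => /(_ ltac:(lia)).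
rewrite (_ : colpoly _ _ _ = R1.[s^-1]); last first.
  by rewrite horner_linepoly; apply: eq_permanent => i j; rewrite split_sum.
move=> /le_trans/(_ (Rt _ _)); rewrite invr_ge0 s0 mulVf ?gt_eqF // => /(_ isT).
set P := \prod_(_ < _ | _) _; set E := expR (- (n - k.+1)%:R) => h.
have E1 : expR (- (n - k)%:R) = E * expR (-1) :> R.
  by rewrite -expRD -opprD natr1 (_ : (n - k.+1).+1 = n - k)%N //; lia.
have e0 : 0 < expR 1 :> R := expR_gt0 1.
rewrite -/u -(ler_pM2l (_ : 0 < k.+1%:R * expR 1)) ?mulr_gt0 ?ltr0n //.
rewrite [leRHS](_ : _ = expR 1 * (k.+1%:R * colpoly B k u)); last by ring.
rewrite -Dk es E1 expRN.
have -> : k.+1%:R * expR 1 * (C * k`!%:R * (E / expR 1) * P) =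
    s * (C * k.+1`!%:R * E * (s^-1 * P)).
  by rewrite factS natrM; field; rewrite !gt_eqF.
rewrite [leRHS](_ : _ = s * (R1.[0] * expR 1)); last by ring.
by rewrite ler_pM2l.
Qed.

Lemma colpoly1 (T : comNzRingType) n (B : 'I_n.+1 -> 'I_n.+1 -> T) :
  colpoly B 1 (B^~ ord0) = permanent B.
Proof.
apply: eq_permanent => i j; rewrite ltnS leqn0; case: eqP => // j0.
by congr B; apply/val_inj.
Qed.

(* Gurvits' capacity bound, with the weaker constant [exp(-n)]. *)
Lemma permanent_capacity_pos (R : realType) n (B : 'I_n -> 'I_n -> R) (C : R) :
  0 <= C -> (forall i j, 0 < B i j) ->
  (forall x : 'I_n -> R, (forall j, 0 < x j) ->
     C * \prod_j x j <= \prod_i \sum_j B i j * x j) ->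
  C * expR (- n%:R) <= permanent B.
Proof.
move=> C0 B0 cap; case: n B B0 cap => [|n] B B0 cap.
  have := cap (fun=> 1) (fun=> ltr01); rewrite !big_ord0 mulr1 oppr0 expR0 mulr1.
  by rewrite -(colpoly0 B (fun=> 0)) colpoly_full big_ord0 mulr1.
(* The descent stops at [k = 1], since for [k = 0] the vector [u] would be an empty sum and not
   positive. At [k = 1] with all variables 1, the replaced column is column 0 itself. *)
have := colpoly_capacity C0 B0 cap (_ : 0 < 1 <= n.+1)%N (fun=> ltr01).
rewrite (eq_bigl (pred1 ord0)); last by move=> j; rewrite ltnS leqn0.
rewrite big_pred1_eq !mulr1 => /(_ isT) h.
have -> : permanent B = colpoly B 1 (fun i => \sum_(j < n.+1 | (j < 1)%N) B i j * 1).
  rewrite -colpoly1; apply: eq_permanent => i j; case: ifP => // _.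
  rewrite (eq_bigl (pred1 ord0)); last by move=> l; rewrite ltnS leqn0.
  by rewrite big_pred1_eq mulr1.
apply: le_trans h; rewrite ler_wpM2l // ler_expR lerN2 ler_nat; lia.
Qed.

(** Adding [e > 0] to every entry preserves the capacity hypothesis and reaches the positive case;
    the permanent is a polynomial in [e], so the change is at most [e * M]. *)
Lemma permanent_capacity (R : realType) n (B : 'I_n -> 'I_n -> R) (C : R) :
  0 <= C -> (forall i j, 0 <= B i j) ->
  (forall x : 'I_n -> R, (forall j, 0 < x j) ->
     C * \prod_j x j <= \prod_i \sum_j B i j * x j) ->
  C * expR (- n%:R) <= permanent B.
Proof.
move=> C0 B0 cap.
pose p : {poly R} := permanent (fun i j => (B i j)%:P + 'X).
have pE e : p.[e] = permanent (fun i j => B i j + e).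
  rewrite -horner_evalE rmorph_permanent; apply: eq_permanent => i j.
  by rewrite /= horner_evalE !hornerE.
have -> : permanent B = p.[0].
  by rewrite pE; apply: eq_permanent => i j; rewrite addr0.
apply: contrapT => /negP; rewrite -ltNge -subr_gt0 => d0.
have [M M0 Mp] : exists2 M : R, 0 < M & forall e, 0 < e <= 1 -> p.[e] <= p.[0] + e * M.
  have /factor_theorem[q' pq'] : root (p - (p.[0])%:P) 0.
    by rewrite rootE !hornerE subrr.
  exists (1 + \sum_(i < size q') `|q'`_i|).
    by rewrite ltr_wpDr // sumr_ge0.
  move=> e /andP[e0 e1].
  have -> : p.[e] = p.[0] + e * q'.[e].
    have := congr1 (horner^~ e) pq'; rewrite hornerM hornerXsubC subr0 !hornerD hornerN hornerC.
    by move/eqP; rewrite subr_eq mulrC addrC => /eqP.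
  rewrite lerD2l ler_pM2l // (le_trans (ler_norm _)) // horner_coef.
  rewrite (le_trans (ler_norm_sum _ _ _)) // ler_wpDl // ler_sum // => i _.
  rewrite normrM ler_piMr // normrX (ger0_norm (ltW e0)) exprn_ile1 //.
  exact: ltW.
set D := C * _ - _ in d0.
pose e := Num.min 1 (D / (2 * M)).
have e0 : 0 < e by rewrite lt_min ltr01 divr_gt0 // mulr_gt0.
have e1 : e <= 1 by rewrite ge_min lexx.
have eM : e * M < D.
  have : e * M <= D / (2 * M) * M by rewrite ler_pM2r // ge_min lexx orbT.
  rewrite (_ : D / (2 * M) * M = D / 2); last by field; rewrite gt_eqF.
  by move=> /le_lt_trans; apply; lra.
have : C * expR (- n%:R) <= p.[e].
  rewrite pE; apply: permanent_capacity_pos => //.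
    by move=> i j; rewrite ltr_wpDl.
  move=> x x0; apply: le_trans (cap x x0) _; apply: ler_prod => i _.
  rewrite sumr_ge0 /=; last by move=> j _; rewrite mulr_ge0 // ltW.
  by apply: ler_sum => j _; rewrite ler_pM2r // lerDl ltW.
have := Mp e; rewrite e0 e1 => /(_ isT) h1 h2.
have : D <= e * M by rewrite /D lerBlDl (le_trans h2).
by rewrite leNgt eM.
Qed.

Lemma ln_prod (R : realType) (I : Type) (r : seq I) (P : pred I) (F : I -> R) :
  (forall i, P i -> 0 < F i) ->
  ln (\prod_(i <- r | P i) F i) = \sum_(i <- r | P i) ln (F i).
Proof.
move=> F0; apply: expR_inj.
rewrite expR_sum lnK ?posrE ?prodr_gt0 //; apply: eq_bigr => i Pi.
by rewrite lnK ?posrE ?F0.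
Qed.

(* A weak form of van der Waerden's bound: weighted AM-GM on each row shows
   that a doubly stochastic matrix has capacity at least 1. *)
Lemma permanent_doubly_stochastic (R : realType) n (B : 'I_n -> 'I_n -> R) :
  (forall i j, 0 <= B i j) ->
  (forall i, \sum_j B i j = 1) -> (forall j, \sum_i B i j = 1) ->
  expR (- n%:R) <= permanent B.
Proof.
move=> B0 rowB colB; rewrite -[leLHS]mul1r.
apply: permanent_capacity => // x x0; rewrite mul1r.
have S0 i : 0 < \sum_j B i j * x j.
  rewrite lt_def sumr_ge0 ?andbT; last by move=> j _; rewrite mulr_ge0 // ltW.
  rewrite psumr_neq0; last by move=> j _; rewrite mulr_ge0 // ltW.
  have : \sum_j B i j != 0 by rewrite rowB oner_eq0.
  rewrite psumr_neq0 => [/hasP[j jT /andP[_ Bij]]|j _]; last exact: B0.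
  by apply/hasP; exists j => //=; rewrite mulr_gt0.
have jensen i : \sum_j B i j * ln (x j) <= ln (\sum_j B i j * x j).
  set S := \sum_j B i j * x j.
  have : \sum_j B i j * ln (x j) <= \sum_j (B i j * ln S + (B i j * x j / S - B i j)).
    apply: ler_sum => j _.
    rewrite [leRHS](_ : _ = B i j * (ln S + (x j / S - 1))); last by ring.
    rewrite ler_wpM2l // -lerBlDl -ln_div ?posrE //; last exact: S0.
    rewrite [X in ln X](_ : _ = 1 + (x j / S - 1)); last by ring.
    by rewrite le_ln1Dx // ltrBrDl addrN divr_gt0 //; exact: S0.
  rewrite big_split /= sumrB -!mulr_suml rowB mul1r -/S divff.
    by rewrite subrr addr0.
  by rewrite gt_eqF //; exact: S0.
rewrite -ler_ln ?posrE ?prodr_gt0 //.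
rewrite !ln_prod //; apply: le_trans (ler_sum _ (fun i _ => jensen i)).
rewrite exchange_big /=; apply: ler_sum => j _.
by rewrite -mulr_suml colB mul1r.
Qed.

(** * Permanents of matrices with small entries *)

Lemma permanent_minor (T : comNzRingType) n (M : 'I_n.+1 -> 'I_n.+1 -> T) i0 j0 :
  \sum_(s : 'S_n.+1 | s i0 == j0) \prod_k M k (s k) =
  M i0 j0 * permanent (fun k l => M (lift i0 k) (lift j0 l)).
Proof.
rewrite (reindex (lift_perm i0 j0)); last first.
  pose ulsf i (s : 'S_n.+1) k := odflt k (unlift (s i) (s (lift i k))).
  have ulsfK i (s : 'S_n.+1) k : lift (s i) (ulsf i s k) = s (lift i k).
    rewrite /ulsf; have := neq_lift i k.
    by rewrite -(can_eq (permK s)) => /unlift_some[] ? ? ->.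
  have inj_ulsf : injective (ulsf i0 _).
    move=> s; apply: can_inj (ulsf (s i0) s^-1%g) _ => k'.
    by rewrite {1}/ulsf ulsfK !permK liftK.
  exists (fun s => perm (inj_ulsf s)) => [s _ | s].
    by apply/permP => k'; rewrite permE /ulsf lift_perm_lift lift_perm_id liftK.
  move/(s _ =P _) => si0; apply/permP => k.
  case: (unliftP i0 k) => [k'|] ->; rewrite ?lift_perm_id //.
  by rewrite lift_perm_lift -si0 permE ulsfK.
rewrite big_distrr /=; apply: eq_big => [s|s _]; first by rewrite lift_perm_id eqxx.
rewrite (bigD1_ord i0) //= lift_perm_id; congr (_ * _).
by apply: eq_bigr => k _; rewrite lift_perm_lift.
Qed.

Lemma permanent_expand_row (T : comNzRingType) n (M : 'I_n.+1 -> 'I_n.+1 -> T) i :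
  permanent M =
  \sum_j M i j * permanent (fun k l => M (lift i k) (lift j l)).
Proof.
rewrite /permanent (partition_big (fun s : 'S_n.+1 => s i) predT) //=.
by apply: eq_bigr => j _; exact: permanent_minor.
Qed.

(** The right side is convex in [z], and the left side is its tangent at [z = y]. *)
Lemma entropy_tangent (R : realType) (y z : R) :
  0 < y -> 0 <= z -> z * ln y + z - y <= z * ln z.
Proof.
move=> y0; rewrite le_eqVlt => /orP[/eqP<-|z0].
  by rewrite !mul0r add0r sub0r oppr_le0 ltW.
have : ln (y / z) <= y / z - 1.
  rewrite [X in ln X](_ : _ = 1 + (y / z - 1)); last by ring.
  by rewrite le_ln1Dx // ltrBrDl addrN divr_gt0.
rewrite ln_div ?posrE // -(ler_pM2l z0).
have -> : z * (y / z - 1) = y - z by field; rewrite gt_eqF.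
by rewrite mulrBr; lra.
Qed.

(* Bregman-Minc for matrices with small entries. [row_bound] replaces
   [log(r!)/r]; it is about [ln r - 1] for [r] close to 1 when [theta] and
   [beta / theta] are small. *)
Definition row_bound (R : realType) (beta theta Rm r : R) : R :=
  (1 - theta) * ln (r + beta / theta) + (2 * theta - 1 + theta * ln Rm).

Lemma row_bound_tangent (R : realType) (beta theta Rm r b : R) :
  0 < beta -> 0 < theta < 1 -> 0 <= b <= r ->
  row_bound beta theta Rm (r - b) <=
  row_bound beta theta Rm r - (1 - theta) * b / (r + beta / theta).
Proof.
move=> b0 /andP[t0 t1] /andP[bb br]; rewrite /row_bound.
set g := beta / theta; have g0 : 0 < g by rewrite divr_gt0.
have rg : 0 < r + g by lra.
have rbg : 0 < r - b + g by lra.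
have : ln ((r - b + g) / (r + g)) <= - (b / (r + g)).
  rewrite [X in ln X](_ : _ = 1 + - (b / (r + g))); last by field; rewrite gt_eqF.
  by rewrite le_ln1Dx // ltrN2 ltr_pdivrMr //; lra.
rewrite ln_div ?posrE // => h.
have : (1 - theta) * (ln (r - b + g) - ln (r + g)) <= (1 - theta) * - (b / (r + g)).
  by rewrite ler_wpM2l // subr_ge0 ltW.
by rewrite -mulrA; lra.
Qed.

(** The shift [beta / theta] is calibrated here: it makes [beta / (r + beta / theta)] at most
    [theta], which one [theta] of the summand [2 * theta - 1] absorbs; the rest cancels [1 - theta].
    The share [theta * ln r] is paid by [theta * ln Rm]. *)
Lemma row_bound_ln (R : realType) (beta theta Rm r : R) :
  0 < beta -> 0 < theta < 1 -> 0 < r <= Rm ->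
  ln r <= row_bound beta theta Rm r +
    (1 - theta) * (r - beta) / (r + beta / theta).
Proof.
move=> b0 /andP[t0 t1] /andP[r0 rR]; rewrite /row_bound.
set g := beta / theta; have g0 : 0 < g by rewrite divr_gt0.
have rg : 0 < r + g by lra.
have : ln (r / (r + g)) <= - (g / (r + g)).
  rewrite [X in ln X](_ : _ = 1 + - (g / (r + g))); last by field; rewrite gt_eqF.
  by rewrite le_ln1Dx // ltrN2 ltr_pdivrMr //; lra.
rewrite ln_div ?posrE // => h.
have h1 : (1 - theta) * (ln r - ln (r + g)) <= (1 - theta) * - (g / (r + g)).
  by rewrite ler_wpM2l // subr_ge0 ltW.
have lnR : theta * ln r <= theta * ln Rm.
  by apply: ler_wpM2l; [exact: ltW|rewrite ler_ln ?posrE // (lt_le_trans r0)].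
have e : (1 - theta) * (r - beta) / (r + g) =
    (1 - theta) - (1 - theta) * (g / (r + g)) - (1 - theta) * (beta / (r + g)).
  by field; rewrite gt_eqF.
have bg : beta / (r + g) <= theta.
  by rewrite ler_pdivrMr // /g mulrDr mulrCA divff ?gt_eqF // mulr1 lerDr mulr_ge0 // ltW.
have : (1 - theta) * (beta / (r + g)) <= theta.
  apply: le_trans bg; rewrite ler_piMl ?divr_ge0 ?ltW //; lra.
rewrite e; lra.
Qed.

(** Convexity of [z ln z] bounds [Z ln (Z / r i)] by a sum over permutations of logarithms of
    minors, which the induction hypothesis controls. Summing over [i] for a fixed permutation [s]
    lets the losses from the deleted columns collect into almost complete row sums. *)
Lemma permanent_small_entries (R : realType) (beta theta Rm : R) n
    (B : 'I_n -> 'I_n -> R) :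
  0 < beta -> 0 < theta < 1 ->
  (forall i j, 0 <= B i j <= beta) -> (forall i, \sum_j B i j <= Rm) ->
  permanent B <= expR (\sum_i row_bound beta theta Rm (\sum_j B i j)).
Proof.
move=> b0 th; elim: n B => [|n IH] B Bb rowR.
  rewrite big_ord0 expR0 /permanent (eq_bigr (fun=> 1)).
    by rewrite sumr_const card_Sn fact0.
  by move=> s _; rewrite big_ord0.
have B0 i j : 0 <= B i j by have /andP[] := Bb i j.
set F := row_bound beta theta Rm; pose r i := \sum_j B i j.
pose Zm i j := permanent (fun k l => B (lift i k) (lift j l)).
have Zm0 i j : 0 <= Zm i j by apply: permanent_ge0.
set Z := permanent B.
have := permanent_ge0 B0; rewrite -/Z le_eqVlt => /orP[/eqP<-|Z0]; first exact: expR_ge0.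
have ZE i : Z = \sum_j B i j * Zm i j by exact: permanent_expand_row.
have r0 i : 0 < r i.
  rewrite lt_def sumr_ge0 // andbT; apply: contraTneq Z0 => ri0.
  rewrite (ZE i) big1 ?ltxx // => j _.
  by rewrite (psumr_eq0P _ ri0) ?mul0r.
pose w (s : 'S_n.+1) := \prod_k B k (s k).
have w0 s : 0 <= w s by apply: prodr_ge0.
pose G i j := \sum_(k | k != i) F (r k - B k j).
have step1 i : Z * (ln Z - ln (r i)) <= \sum_(s : 'S_n.+1) w s * G i (s i).
  have y0 : 0 < Z / r i by rewrite divr_gt0.
  have h j : B i j * (Zm i j * ln (Z / r i) + Zm i j - Z / r i) <=
      \sum_(s : 'S_n.+1 | s i == j) w s * G i (s i).
    rewrite (eq_bigr (fun s => w s * G i j)) => [|s /eqP->//].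
    rewrite -mulr_suml permanent_minor -/(Zm i j) -mulrA ler_wpM2l //.
    apply: le_trans (entropy_tangent y0 (Zm0 i j)) _.
    have := Zm0 i j; rewrite le_eqVlt => /orP[/eqP<-|z0]; first by rewrite !mul0r.
    rewrite ler_pM2l // -(ler_expR (ln _)) lnK ?posrE //.
    apply: le_trans (IH _ _ _) _ => [k l|k|].
    - exact: Bb.
    - apply: le_trans (rowR (lift i k)); rewrite [leRHS](bigD1_ord j) //= lerDr //.
    - have -> : G i j = \sum_(k < n) F (r (lift i k) - B (lift i k) j).
        rewrite /G big_mkcond (bigD1_ord i) //= eqxx add0r.
        by apply: eq_bigr => k _; rewrite eq_sym neq_lift.
      rewrite ler_expR; apply: ler_sum => k _.
      by rewrite /r [X in F (X - _)](bigD1_ord j) //= addrAC subrr add0r.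
  have : \sum_j B i j * (Zm i j * ln (Z / r i) + Zm i j - Z / r i) <=
      \sum_(s : 'S_n.+1) w s * G i (s i).
    rewrite [leRHS](partition_big (fun s : 'S_n.+1 => s i) predT) //=.
    by apply: ler_sum => j _; exact: h.
  apply: le_trans.
  rewrite (eq_bigr (fun j => B i j * Zm i j * (ln (Z / r i) + 1) - B i j * (Z / r i))).
    have e : r i * (Z / r i) = Z by field; rewrite gt_eqF.
    rewrite sumrB -!mulr_suml -ZE -/(r i) e.
    by rewrite ln_div ?posrE // (mulrDr Z (_ - _) 1) mulr1 addrK.
  by move=> j _; ring.
have step2 (s : 'S_n.+1) : \sum_i G i (s i) <= \sum_k (n.+1%:R * F (r k) - ln (r k)).
  rewrite /G (exchange_big_dep predT) //=; apply: ler_sum => k _.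
  have Bk j : B k j <= r k by rewrite /r (bigD1 j) //= lerDl sumr_ge0.
  have : \sum_(i | k != i) F (r k - B k (s i)) <=
      \sum_(i | k != i) (F (r k) - B k (s i) * ((1 - theta) / (r k + beta / theta))).
    apply: ler_sum => i _; have := @row_bound_tangent _ beta theta Rm (r k) (B k (s i)) b0 th.
    rewrite B0 Bk => /(_ isT); rewrite -/F; congr (_ <= _ - _); ring.
  move=> /le_trans; apply.
  rewrite sumrB -mulr_suml sumr_const.
  have -> : #|[pred i : 'I_n.+1 | k != i]| = n.
    by rewrite (@eq_card _ _ (predC1 k)) ?cardC1 ?card_ord // => i; rewrite !inE eq_sym.
  have -> : \sum_(i | k != i) B k (s i) = r k - B k (s k).
    rewrite /r [in RHS](reindex_inj (@perm_inj _ s)) /= [in RHS](bigD1 k) //= addrAC subrr add0r.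
    by apply: eq_bigl => i; rewrite eq_sym.
  have /andP[t0 t1] := th.
  have := @row_bound_ln _ beta theta Rm (r k) b0 th; rewrite r0 rowR => /(_ isT).
  rewrite -/F -mulrA mulrCA => hk.
  set q := (1 - theta) / _ in hk *.
  have q0 : 0 <= q.
    by rewrite divr_ge0 ?subr_ge0 ?ltW // addr_gt0 ?divr_gt0.
  have : (r k - beta) * q <= (r k - B k (s k)) * q.
    by rewrite ler_wpM2r // lerB //; have /andP[] := Bb k (s k).
  by rewrite -mulr_natl -natr1; lra.
have : \sum_i Z * (ln Z - ln (r i)) <= Z * \sum_k (n.+1%:R * F (r k) - ln (r k)).
  apply: le_trans (ler_sum _ (fun i _ => step1 i)) _.
  rewrite exchange_big /= mulr_suml; apply: ler_sum => s _.
  by rewrite -mulr_sumr ler_wpM2l.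
rewrite -mulr_sumr ler_pM2l // !sumrB lerD2r sumr_const card_ord -mulr_sumr.
by rewrite -[ln Z *+ _]mulr_natl ler_pM2l ?ltr0n // -(ler_expR (ln Z)) lnK ?posrE.
Qed.

(** * Correcting an almost doubly stochastic matrix *)

(** Each [z i] is a weighted mean of its neighbours plus [d i], where [d i] is at most [2 * e] in
    absolute value. For the largest difference [D] within a class this yields
    [D <= 4 e + (1 - 2 o / 3) D], so [D <= 6 e / o]; one more averaging step compares the two
    classes. *)
Lemma laplacian_osc (R : realFieldType) (V : finType) (b : V -> V -> R)
    (cl : V -> bool) (U : {pred V}) (o e : R) (z : V -> R) :
  (forall i j, 0 <= b i j) ->
  (forall i j, b i j != 0 -> [&& i \in U, j \in U & cl i != cl j]) ->
  (forall i, i \in U -> 2^-1 <= \sum_j b i j <= 3 / 2) ->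
  0 < o <= 1 ->
  (forall i i', i \in U -> i' \in U -> cl i = cl i' ->
     o <= \sum_j Num.min (b i j) (b i' j)) ->
  (forall i, i \in U -> `|\sum_j b i j * (z i - z j)| <= e) ->
  forall i j, i \in U -> j \in U -> `|z i - z j| <= 8 * e / o.
Proof.
move=> b0 bU rU /andP[ o0 o1] ov Lz.
pose r i := \sum_j b i j.
have r0 i : i \in U -> 0 < r i by move=> /rU/andP[h _]; apply: lt_le_trans h; rewrite invr_gt0.
pose d i := (\sum_j b i j * (z i - z j)) / r i.
have dle i : i \in U -> `|d i| <= 2 * e.
  move=> iU; have ri0 := r0 i iU; have /andP[r2 _] := rU i iU.
  rewrite normrM normfV (gtr0_norm ri0) ler_pdivrMr //.
  apply: le_trans (Lz i iU) _.
  have e0 : 0 <= e := le_trans (normr_ge0 _) (Lz i iU).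
  have : e * 2^-1 <= e * r i by rewrite ler_wpM2l.
  lra.
have zE i c : i \in U -> z i - c = d i + \sum_j b i j / r i * (z j - c).
  move=> iU; have ri0 := r0 i iU.
  have -> : \sum_j b i j / r i * (z j - c) = (\sum_j b i j * (z j - c)) / r i.
    by rewrite mulr_suml; apply: eq_bigr => j _; ring.
  rewrite /d -mulrDl -big_split /=.
  rewrite (eq_bigr (fun j => b i j * (z i - c))); last by move=> j _; ring.
  by rewrite -mulr_suml -/(r i); field; rewrite gt_eqF.
have sump i : i \in U -> \sum_j b i j / r i = 1.
  by move=> iU; rewrite -mulr_suml divff // gt_eqF // r0.
have e0' i : i \in U -> 0 <= e by move=> /Lz; apply: le_trans.
(* Two vertices of the same class share mass at least [o], so the oscillation
   inside a class contracts. *)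
have same i i' : i \in U -> i' \in U -> cl i = cl i' -> z i - z i' <= 6 * e / o.
  move=> iU i'U cii'.
  pose Q (x : V * V) := [&& x.1 \in U, x.2 \in U & cl x.1 == cl x.2].
  have Q0 : Q (i, i') by rewrite /Q /= iU i'U cii' eqxx.
  (* The maximum is over pairs from either class, because the neighbours of one class lie in the
     other and their oscillation must also be at most [D]. *)
  case: (arg_maxP (fun x : V * V => z x.1 - z x.2) Q0) => -[k k'] /=.
  move=> /and3P[/= kU k'U /eqP ck] kmax.
  apply: le_trans (kmax (i, i') Q0) _ => /=; set D := z k - z k' in kmax *.
  have kk0 := r0 k kU; have kk0' := r0 k' k'U.
  have [j1 bj1] : exists j, b k j != 0.
    apply/existsP; apply: contraT => /existsPn nob; move: kk0.
    by rewrite /r big1 ?ltxx // => j _; apply/eqP; have := nob j; rewrite negbK.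
  have /and3P[_ j1U cj1] := bU _ _ bj1.
  pose Pm j := (j \in U) && (cl k != cl j).
  have Pm1 : Pm j1 by rewrite /Pm j1U cj1.
  case: (arg_minP z Pm1) => m /andP[mU cm] mmin.
  have zm j : (j \in U) && (cl k != cl j) -> 0 <= z j - z m <= D.
    move=> Pj; rewrite subr_ge0 mmin //=; have /andP[jU cj] := Pj.
    by apply: (kmax (j, m)); rewrite /Q /= jU mU /=; case: (cl k) (cl j) (cl m) cj cm => [] [] [].
  have D0 : 0 <= D by have /andP[h1 h2] := zm _ Pm1; apply: le_trans h1 h2.
  pose mn j := Num.min (b k j / r k) (b k' j / r k').
  have mnsum : 2 / 3 * o <= \sum_j mn j.
    have := ov k k' kU k'U ck; rewrite -(ler_pM2l (_ : 0 < 2 / 3)); last by lra.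
    move=> /le_trans; apply; rewrite mulr_sumr; apply: ler_sum => j _.
    have scale x : x \in U -> 2 / 3 * b x j <= b x j / r x.
      move=> xU; have /andP[_ rx] := rU x xU; have rx0 := r0 x xU.
      rewrite mulrC ler_wpM2l // -[leLHS]invf_div lef_pV2 ?posrE //; lra.
    rewrite le_min; apply/andP; split.
      by apply: le_trans (scale k kU); rewrite ler_pM2l ?ge_min ?lexx //; lra.
    by apply: le_trans (scale k' k'U); rewrite ler_pM2l ?ge_min ?lexx ?orbT //; lra.
  have DE : D = d k - d k' + \sum_j (b k j / r k - b k' j / r k') * (z j - z m).
    have -> : D = (z k - z m) - (z k' - z m) by rewrite /D; ring.
    rewrite (zE k) // (zE k' (z m)) //.
    rewrite [in RHS](eq_bigr (fun j => b k j / r k * (z j - z m) - b k' j / r k' * (z j - z m))).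
      by rewrite sumrB; ring.
    by move=> j _; ring.
  have sumle : \sum_j (b k j / r k - b k' j / r k') * (z j - z m) <= (1 - 2 / 3 * o) * D.
    apply: le_trans (_ : \sum_j (b k j / r k - mn j) * D <= _).
      apply: ler_sum => j _.
      have [Pj|nPj] := boolP (Pm j); last first.
        have b1 : b k j = 0.
          by apply: contraNeq nPj => /bU/and3P[_ ? ?]; apply/andP.
        have b2 : b k' j = 0.
          by apply: contraNeq nPj => /bU/and3P[_ ? ?]; apply/andP; rewrite ck.
        by rewrite /mn b1 b2 !mul0r minxx !subrr !mul0r lexx.
      have /andP[h1 h2] := zm j Pj.
      apply: le_trans (_ : (b k j / r k - mn j) * (z j - z m) <= _).
        by rewrite ler_wpM2r // lerB // /mn ge_min lexx orbT.
      by rewrite ler_wpM2l // subr_ge0 /mn ge_min lexx.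
    rewrite -mulr_suml sumrB sump // ler_wpM2r // lerB //.
  have := dle k kU; have := dle k' k'U; rewrite !ler_norml => /andP[a1 a2] /andP[a3 a4].
  rewrite ler_pdivlMr //; nra.
move=> i j iU jU.
have sameN x y : x \in U -> y \in U -> cl x = cl y -> `|z x - z y| <= 6 * e / o.
  by move=> xU yU cxy; rewrite ler_norml lerNl opprB !same.
have e0 := e0' i iU.
have e68 : 6 * e / o + 2 * e <= 8 * e / o.
  have : 2 * e <= 2 * e / o by rewrite ler_pdivlMr // ler_piMr // mulr_ge0.
  by lra.
have [cij|cij] := eqVneq (cl i) (cl j).
  apply: le_trans (sameN i j iU jU cij) _; lra.
rewrite (zE i) //; apply: le_trans (ler_normD _ _) _.
rewrite addrC; apply: le_trans e68; apply: lerD; last exact: dle.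
apply: le_trans (ler_norm_sum _ _ _) _.
have -> : 6 * e / o = \sum_k b i k / r i * (6 * e / o).
  by rewrite -mulr_suml sump // mul1r.
apply: ler_sum => k _.
have p0 : 0 <= b i k / r i by rewrite divr_ge0 // ltW // r0.
rewrite normrM (ger0_norm p0).
have [->|bik] := eqVneq (b i k) 0; first by rewrite !mul0r.
have /and3P[_ kU cik] := bU _ _ bik.
rewrite ler_wpM2l // sameN //; by case: (cl i) (cl j) (cl k) cij cik => [] [] [].
Qed.

(** The entries are [b i j * (1 + s i * (z i - z j))] with opposite signs [s] on the two classes,
    which keeps them symmetric. Unit row sums become a Laplace equation for [z], whose right side
    has sum zero because [b] is symmetric and the classes are equally large; [laplacian_osc] bounds
    the relative change. *)
Lemma doubly_stochastic_correction (R : realFieldType) (V : finType)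
    (b : V -> V -> R) (cl : V -> bool) (U : {pred V}) (o eta : R) :
  (forall i j, 0 <= b i j) -> (forall i j, b i j = b j i) ->
  (forall i j, b i j != 0 -> [&& i \in U, j \in U & cl i != cl j]) ->
  (forall i, i \in U -> `|\sum_j b i j - 1| <= eta) ->
  0 < o <= 1 -> 8 * eta / o <= 2^-1 ->
  (forall i i', i \in U -> i' \in U -> cl i = cl i' ->
     o <= \sum_j Num.min (b i j) (b i' j)) ->
  #|[pred i in U | cl i]| = #|[pred i in U | ~~ cl i]| ->
  exists B : V -> V -> R,
    [/\ forall i j, 0 <= B i j <= b i j * (1 + 8 * eta / o),
        forall i j, B i j = B j i &
        forall i, i \in U -> \sum_j B i j = 1].
Proof.
move=> b0 bs bU rU o01 small ov card.
have /andP[ o0 o1] := o01.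
have rU' i : i \in U -> 2^-1 <= \sum_j b i j <= 3 / 2.
  move=> iU; have := rU i iU.
  have eta0 : 0 <= eta := le_trans (normr_ge0 _) (rU i iU).
  have : eta <= 2^-1.
    apply: le_trans small; rewrite -mulrA mulrCA ler_peMr // ler_pdivlMr //; lra.
  rewrite ler_norml => ? /andP[? ?]; lra.
pose L (z : V -> R) i := \sum_j b i j * (z i - z j).
have sumL z : \sum_(i in U) L z i = 0.
  have -> : \sum_(i in U) L z i = \sum_i L z i.
    rewrite big_mkcond; apply: eq_bigr => i _; case: ifPn => // iU.
    rewrite /L big1 // => j _.
    suff -> : b i j = 0 by rewrite mul0r.
    by apply: contraNeq iU => /bU/and3P[].
  have : \sum_i L z i = - \sum_i L z i.
    rewrite [LHS]exchange_big /= -sumrN; apply: eq_bigr => i _.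
    rewrite /L -sumrN; apply: eq_bigr => j _; rewrite bs; ring.
  lra.
pose W := {ffun V -> R^o}.
(* The Laplacian kills constants. Adding the total over [U] makes the map injective, and this total
   vanishes whenever the right side has sum zero; outside [U] the map is the identity. *)
pose Tf (z : W) : W := [ffun i => if i \in U then L z i + \sum_(j in U) z j else z i].
have Tlin : linear Tf.
  move=> a x y; apply/ffunP => i; rewrite !ffunE; case: ifP => // _.
  rewrite /L scalerDr addrACA; congr (_ + _).
    rewrite scaler_sumr -big_split /=; apply: eq_bigr => j _; rewrite !ffunE /GRing.scale /=; ring.
  by rewrite scaler_sumr -big_split /=; apply: eq_bigr => j _; rewrite !ffunE.
pose TL : {linear W -> W} := HB.pack Tf (GRing.isLinear.Build _ _ _ _ Tf Tlin).
pose T := linfun TL.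
have TE z : T z = Tf z by rewrite lfunE.
have avg (z : W) (rho : V -> R) : (forall i, i \in U -> Tf z i = rho i) -> \sum_(i in U) rho i = 0 ->
    forall i, i \in U -> L z i = rho i.
  move=> Tz s0 i iU.
  have S0 : \sum_(j in U) z j = 0.
    have : \sum_(i in U) (L z i + \sum_(j in U) z j) = 0.
      by rewrite -[RHS]s0; apply: eq_bigr => k kU; rewrite -Tz // ffunE kU.
    rewrite big_split /= sumL add0r sumr_const => /eqP.
    rewrite mulrn_eq0 => /orP[/eqP U0|/eqP//].
    by have := card0_eq U0 i; rewrite inE /= iU.
  by rewrite -Tz // ffunE iU S0 addr0.
have kerT : lker T == 0%VS.
  apply/lker0P => x y; rewrite !TE => Txy.
  apply/eqP; rewrite -subr_eq0; apply/eqP; set z := x - y.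
  have Tz : Tf z = 0 by rewrite /z -[Tf _]/(TL (x - y)) linearB /= Txy subrr.
  have Tz0 i : Tf z i = 0 by rewrite Tz ffunE.
  have Lz i : i \in U -> L z i = 0.
    move=> iU; rewrite (avg z (fun=> 0) (fun i _ => Tz0 i)) // big1 //.
  have osc := @laplacian_osc _ _ b cl U o 0 z b0 bU rU' o01 ov.
  have {}osc i j : i \in U -> j \in U -> z i = z j.
    move=> iU jU; apply/eqP; rewrite -subr_eq0 -normr_le0.
    by have := osc _ i j iU jU; rewrite mulr0 mul0r; apply => k kU; rewrite -/(L z k) Lz // normr0.
  apply/ffunP => i; rewrite [RHS]ffunE; have := Tz0 i.
  rewrite ffunE; case: ifP => // iU.
  rewrite Lz // add0r (eq_bigr (fun=> z i)); last by move=> j jU; exact: osc.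
  rewrite sumr_const => /eqP; rewrite mulrn_eq0 => /orP[/eqP U0|/eqP//].
  by have := card0_eq U0 i; rewrite inE /= iU.
pose s i : R := if cl i then 1 else -1.
pose rho : W := [ffun i => if i \in U then s i * (1 - \sum_j b i j) else 0].
have rho0 : \sum_(i in U) rho i = 0.
  rewrite (eq_bigr (fun i => s i - s i * \sum_j b i j)); last first.
    by move=> i iU; rewrite ffunE iU; ring.
  have s0 : \sum_(i in U) s i = 0.
    rewrite (bigID cl) /= (eq_bigr (fun=> 1)); last by move=> i /andP[_ ci]; rewrite /s ci.
    rewrite [X in _ + X](eq_bigr (fun=> -1)); last by move=> i /andP[_ /negPf ci]; rewrite /s ci.
    rewrite !sumr_const mulNrn.
    rewrite (_ : #|_| = #|[pred i in U | cl i]|); last by apply: eq_card => i; rewrite !inE.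
    apply/eqP; rewrite card subr_eq0; apply/eqP; congr (_ *+ _).
  rewrite sumrB s0 sub0r; apply/eqP; rewrite oppr_eq0; apply/eqP.
  have e : \sum_(i in U) s i * \sum_j b i j = \sum_i \sum_j s i * b i j.
    rewrite big_mkcond; apply: eq_bigr => i _; rewrite mulr_sumr; case: ifPn => // iU.
    rewrite big1 // => j _; apply/eqP; rewrite mulf_eq0 orbC.
    by apply: contraNT iU; move=> /norP[/bU/and3P[]].
  rewrite e; have : \sum_i \sum_j s i * b i j = - \sum_i \sum_j s i * b i j.
    rewrite [LHS]exchange_big /= -sumrN; apply: eq_bigr => i _.
    rewrite -sumrN; apply: eq_bigr => j _; rewrite (bs j i).
    have [->|/bU/and3P[_ _]] := eqVneq (b i j) 0; first by rewrite !mulr0 oppr0.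
    by rewrite /s; case: (cl i) (cl j) => [] [] // _; ring.
  lra.
have [z Tz] : exists z : W, Tf z = rho.
  have : rho \in limg T by rewrite (lker0_limgf kerT) memvf.
  by case/memv_imgP => z _ ->; exists z; rewrite TE.
have Lz := avg z rho (fun i _ => congr1 (fun f : W => f i) Tz) rho0.
have osc i j : i \in U -> j \in U -> `|z i - z j| <= 8 * eta / o.
  apply: (@laplacian_osc _ _ b cl U o eta z) => // k kU.
  rewrite -/(L z k) Lz // ffunE kU normrM distrC.
  rewrite (_ : `|s k| = 1) ?mul1r ?rU //.
  by rewrite /s; case: ifP => _; rewrite ?normrN normr1.
have sle i x : `|s i * x| = `|x|.
  by rewrite /s; case: ifP => _; rewrite ?mul1r // mulN1r normrN.
exists (fun i j => b i j * (1 + s i * (z i - z j))); split.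
- move=> i j; have [->|bij] := eqVneq (b i j) 0; first by rewrite !mul0r lexx.
  have /and3P[iU jU _] := bU _ _ bij.
  have := osc i j iU jU; rewrite -(sle i) ler_norml => /andP[h1 h2].
  rewrite mulr_ge0 //=; last by lra.
  by rewrite ler_wpM2l // lerD2l.
- move=> i j; rewrite (bs j i); have [->|/bU/and3P[_ _]] := eqVneq (b i j) 0.
    by rewrite !mul0r.
  by rewrite /s; case: (cl i) (cl j) => [] [] // _; ring.
- move=> i iU; have := Lz i iU; rewrite ffunE iU => Lzi.
  rewrite (eq_bigr (fun j => b i j + s i * (b i j * (z i - z j)))).
    rewrite big_split /= -mulr_sumr -/(L z i) Lzi.
    have ss : s i * s i = 1 by rewrite /s; case: ifP => _; rewrite ?mulrNN mulr1.
    by rewrite mulrA ss mul1r addrC subrK.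
  by move=> j _; ring.
Qed.

(** * Sieve estimates *)

Lemma big_multiples (T : Type) (idx : T) (op : Monoid.law idx) (f : nat -> T) p N :
  (0 < p)%N ->
  \big[op/idx]_(1 <= b < N.+1 | (p %| b)%N) f b =
  \big[op/idx]_(1 <= b < (N %/ p).+1) f (p * b)%N.
Proof.
move=> p0; elim: N => [|N IH]; first by rewrite div0n !big_geq.
rewrite big_mkcond big_nat_recr //= -big_mkcond IH divnS //.
case: (boolP (p %| N.+1)%N) => [pN|_]; last by rewrite add0n Monoid.mulm1.
rewrite add1n [in RHS]big_nat_recr //=; congr (op _ (f _)).
by rewrite -[in RHS]add1n -{1}[N.+1](divnK pN) mulnC divnS // pN.
Qed.

Definition sieve_weight (R : realFieldType) (L : seq nat) (lam : nat -> R) (b : nat) : R :=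
  \prod_(p <- L) (if (p %| b)%N then 1 + lam p else 1).

Definition sieve_sum (R : realFieldType) (L : seq nat) (lam : nat -> R) (N : nat) : R :=
  \sum_(1 <= b < N.+1) sieve_weight L lam b.

(* A fundamental lemma of the sieve that is cheap because the weights
   [`|lam p|] are summable apart from the primes dividing a fixed integer. *)
Lemma sieve_sum_approx (R : realFieldType) (L : seq nat) (lam : nat -> R) :
  uniq L -> all prime L -> forall y k, (0 < k)%N ->
  `|sieve_sum L lam (y %/ k) - y%:R / k%:R * \prod_(p <- L) (1 + lam p / p%:R)|
  <= \prod_(p <- L) (1 + `|lam p|).
Proof.
elim: L => [_ _|p L IH /= /andP[pL uL] /andP[pp pL']] y k k0.
  have -> : sieve_sum [::] lam (y %/ k) = (y %/ k)%:R.
    rewrite /sieve_sum (eq_bigr (fun=> 1)); last by move=> b _; rewrite /sieve_weight big_nil.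
    by rewrite sumr_const_nat subSS subn0.
  rewrite !big_nil mulr1.
  have k0' : 0 < k%:R :> R by rewrite ltr0n.
  have h1 : (y %/ k)%:R <= y%:R / k%:R :> R.
    by rewrite ler_pdivlMr // -natrM ler_nat leq_trunc_div.
  have h2 : y%:R / k%:R <= (y %/ k)%:R + 1 :> R.
    by rewrite ler_pdivrMr // natr1 -natrM ler_nat ltnW // ltn_ceil.
  by rewrite ler_norml; apply/andP; split; lra.
have p0 : (0 < p)%N := prime_gt0 pp.
have p0' : p%:R != 0 :> R by rewrite pnatr_eq0 -lt0n.
have k0' : k%:R != 0 :> R by rewrite pnatr_eq0 -lt0n.
have FM b : sieve_weight L lam (p * b)%N = sieve_weight L lam b.
  rewrite /sieve_weight big_seq [in RHS]big_seq; apply: eq_bigr => q qL.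
  have qp := allP pL' q qL; rewrite Euclid_dvdM // dvdn_prime2 //.
  by rewrite (negPf (memPn pL _ qL)).
(* The multiples of [p] rescale to an interval shorter by the factor [p] with unchanged weights;
   this is why the statement carries a divisor [k]. *)
have -> : sieve_sum (p :: L) lam (y %/ k) =
    sieve_sum L lam (y %/ k) + lam p * sieve_sum L lam (y %/ (k * p)).
  have -> : sieve_sum L lam (y %/ (k * p)) =
      \sum_(1 <= b < (y %/ k).+1 | (p %| b)%N) sieve_weight L lam b.
    by rewrite big_multiples // divnMA; apply: eq_bigr => b _; rewrite FM.
  rewrite /sieve_sum mulr_sumr.
  rewrite [X in _ + X]big_mkcond -big_split /=; apply: eq_bigr => b _.
  by rewrite /sieve_weight big_cons; case: ifP => _; ring.
rewrite !big_cons.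
have h1 := IH uL pL' y k k0; have := IH uL pL' y (k * p)%N.
rewrite muln_gt0 k0 p0 natrM => /(_ isT).
set P := \prod_(_ <- _) (1 + _ / _) in h1 *.
set Q := \prod_(_ <- _) (1 + `|_|) in h1 * => h2.
set S1 := sieve_sum L lam (y %/ k) in h1 *.
set S2 := sieve_sum L lam (y %/ (k * p)) in h2 *.
rewrite (_ : _ - _ = (S1 - y%:R / k%:R * P) +
    lam p * (S2 - y%:R / (k%:R * p%:R) * P)); last first.
  by field; rewrite k0' p0'.
apply: le_trans (ler_normD _ _) _; rewrite mulrDl mul1r normrM lerD //.
by rewrite ler_wpM2l.
Qed.

(** * Products over primes and the divisor bound *)

Definition primes_upto (n : nat) : seq nat := [seq p <- index_iota 0 n.+1 | prime p].

Lemma primes_upto_uniq n : uniq (primes_upto n).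
Proof. by rewrite filter_uniq // iota_uniq. Qed.

Lemma mem_primes_upto n p : (p \in primes_upto n) = prime p && (p <= n)%N.
Proof. by rewrite mem_filter mem_index_iota ltnS. Qed.

Lemma primes_upto_prime n : all prime (primes_upto n).
Proof. exact: filter_all. Qed.

(* 2^omega(i), provided [0 < i <= n]. *)
Definition omega2 (n i : nat) : nat :=
  (\prod_(p <- primes_upto n) (if p %| i then 2 else 1))%N.

Lemma prod_prime_dvd (L : seq nat) i : uniq L -> all prime L ->
  (\prod_(p <- L) (if p %| i then p else 1) %| i)%N.
Proof.
elim: L => [_ _|p L IH /= /andP[pL uL] /andP[pp pL']].
  by rewrite big_nil dvd1n.
rewrite big_cons; case: ifP => [pi|_]; last by rewrite mul1n IH.
rewrite Gauss_dvd ?pi ?IH //.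
rewrite coprime_sym big_seq; elim/big_ind: _ => [|x y hx hy|q qL].
- by rewrite coprime1n.
- by rewrite coprimeMl hx hy.
- case: ifP => _; last by rewrite coprime1n.
  have qp := allP pL' q qL; rewrite prime_coprime // dvdn_prime2 //.
  exact: (memPn pL).
Qed.

Lemma prod_small_const M n :
  (\prod_(p <- primes_upto n) (if p < M then M else 1) <= M ^ M)%N.
Proof.
case: M => [|M]; first by rewrite big1.
rewrite big_filter.
apply: (@leq_trans (\prod_(0 <= p < n.+1) (if p < M.+1 then M.+1 else 1))%N).
  rewrite big_mkcond; apply: leq_prod => p _.
  by case: (prime p) => //; case: ifP.
have -> : (\prod_(0 <= p < n.+1) (if p < M.+1 then M.+1 else 1) = M.+1 ^ minn n.+1 M.+1)%N.
  elim: n.+1 => [|m IH]; first by rewrite big_geq // min0n.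
  rewrite big_nat_recr //= IH; case: (ltnP m M.+1) => mM.
    by rewrite (minn_idPl mM) expnSr.
  by rewrite (minn_idPr (leqW mM)) muln1.
by rewrite leq_pexp2l ?geq_minr.
Qed.

(** A prime [p >= 2^K] dividing [i] pays for its factor [2^K] with [p] itself, and the smaller
    primes contribute a constant: hence 2^omega(i) is O(i^(1/K)). *)
Lemma omega2_bound K n i : (0 < i)%N ->
  (omega2 n i ^ K <= (2 ^ K) ^ (2 ^ K) * i)%N.
Proof.
move=> i0; set M := (2 ^ K)%N.
apply: leq_trans (_ : (\prod_(p <- primes_upto n) (if p < M then M else 1)) *
  (\prod_(p <- primes_upto n) (if p %| i then p else 1)) <= _)%N; last first.
  rewrite leq_mul ?prod_small_const //.
  by rewrite dvdn_leq // prod_prime_dvd ?primes_upto_uniq ?primes_upto_prime.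
rewrite -big_split /= /omega2.
have -> : ((\prod_(p <- primes_upto n) (if p %| i then 2 else 1)) ^ K =
    \prod_(p <- primes_upto n) (if p %| i then M else 1))%N.
  elim: (primes_upto n) => [|p L IH]; first by rewrite !big_nil exp1n.
  by rewrite !big_cons expnMn IH; case: ifP; rewrite ?exp1n.
have M0 : (0 < M)%N by rewrite expn_gt0.
rewrite big_seq [leqRHS]big_seq; apply: leq_prod => p; rewrite mem_primes_upto => /andP[pp _].
have p0 := prime_gt0 pp.
by case: ifP => _; case: (ltnP p M) => Mp; rewrite ?muln1 ?mul1n ?leq_pmulr.
Qed.

Lemma omega2_gt0 n i : (0 < omega2 n i)%N.
Proof.
rewrite /omega2; elim/big_ind: _ => // [x y x0 y0|p _]; first by rewrite muln_gt0 x0.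
by case: ifP.
Qed.

Lemma coprime_primes_upto n i j : (0 < i <= n)%N ->
  coprime i j = all (fun p => ~~ ((p %| i)%N && (p %| j)%N)) (primes_upto n).
Proof.
move=> /andP[i0 iN]; apply/idP/allP => [cij p|h].
  rewrite mem_primes_upto => /andP[pp _]; apply/negP => /andP[pi pj].
  have : (p %| gcdn i j)%N by rewrite dvdn_gcd pi.
  by rewrite (eqP cij) dvdn1 => /eqP p1; rewrite p1 in pp.
apply/negPn/negP => ncij; have g1 : (1 < gcdn i j)%N.
  by rewrite ltn_neqAle eq_sym gcdn_gt0 i0 andbT.
have hp : pdiv (gcdn i j) \in primes_upto n.
  rewrite mem_primes_upto pdiv_prime //=.
  apply: leq_trans iN; apply: leq_trans (pdiv_leq _) _; first exact: ltnW.
  by rewrite dvdn_leq // dvdn_gcdl.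
have := h _ hp.
by rewrite !(dvdn_trans (pdiv_dvd _)) ?dvdn_gcdl ?dvdn_gcdr.
Qed.

(** * Local weights and row sums *)

Definition ratio (R : realFieldType) (p : nat) : R := (p%:R - 1) / (p%:R - 2).
Definition kappa (R : realFieldType) (p : nat) : R :=
  p%:R * (p%:R - 2) / (p%:R - 1) ^+ 2.
Definition oddsmall (z p : nat) : bool := (2 < p <= z)%N.

Definition hweight (R : realFieldType) (n z i : nat) : R :=
  \prod_(p <- primes_upto n) (if oddsmall z p && (p %| i)%N then ratio R p else 1).
Definition hmax (R : realFieldType) (n z : nat) : R :=
  \prod_(p <- primes_upto n) (if oddsmall z p then ratio R p else 1).
Definition kappa_prod (R : realFieldType) (n z : nat) : R :=
  \prod_(p <- primes_upto n) (if oddsmall z p then kappa R p else 1).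
Definition norm_const (R : realFieldType) (n z : nat) : R :=
  2 / n%:R * kappa_prod R n z.
(** The value [-1] annihilates every [j] sharing [p] with [i], and [ratio R p - 1] inserts the
    weight; with [z = 0] only the coprimality condition is left. *)
Definition coprime_weight (R : realFieldType) (z i p : nat) : R :=
  if (p %| i)%N then -1 else if oddsmall z p then ratio R p - 1 else 0.
(** Primes above [z] carry no weight, so those dividing [i] leave their density factor in the row
    sum. *)
Definition large_part (R : realFieldType) (n z i : nat) : R :=
  \prod_(p <- primes_upto n) (if (z < p)%N && (p %| i)%N then 1 - p%:R^-1 else 1).

Lemma ratio_ge1 (R : realFieldType) z p : oddsmall z p -> 1 <= ratio R p.
Proof.
move=> /andP[p2 _]; have p2' : 2 < p%:R :> R by rewrite ltr_nat.
by rewrite /ratio ler_pdivlMr; lra.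
Qed.

Lemma kappa_itv (R : realFieldType) z p : oddsmall z p -> 0 < kappa R p <= 1.
Proof.
move=> /andP[p2 _]; have p2' : 2 < p%:R :> R by rewrite ltr_nat.
have p1 : 0 < (p%:R - 1) ^+ 2 :> R by rewrite exprn_gt0 //; lra.
rewrite /kappa divr_gt0 ?mulr_gt0 //=; try lra.
by rewrite ler_pdivrMr // mul1r; nra.
Qed.

Lemma prodr_ge1 (R : numDomainType) (I : Type) (r : seq I) (F : I -> R) :
  (forall i, 1 <= F i) -> 1 <= \prod_(i <- r) F i.
Proof.
move=> F1; elim/big_ind: _ => // x y x1 y1.
by rewrite (le_trans x1) // ler_peMr // (le_trans ler01).
Qed.

Lemma le_prod_seq (R : numDomainType) (I : eqType) (r : seq I) (F G : I -> R) :
  {in r, forall i, 0 <= F i <= G i} -> \prod_(i <- r) F i <= \prod_(i <- r) G i.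
Proof. by move=> FG; rewrite big_seq [leRHS]big_seq ler_prod. Qed.

Lemma prod_seq_le1 (R : numDomainType) (I : eqType) (r : seq I) (F : I -> R) :
  {in r, forall i, 0 <= F i <= 1} -> \prod_(i <- r) F i <= 1.
Proof. by move=> /le_prod_seq; rewrite big1_eq. Qed.

Lemma hweight_itv (R : realFieldType) n z i : 1 <= hweight R n z i <= hmax R n z.
Proof.
rewrite prodr_ge1 /=; last by move=> p; case: ifP => // /andP[h _]; exact: ratio_ge1 h.
apply: le_prod_seq => p _; case: (boolP (oddsmall z p)) => h /=; last by rewrite ler01 lexx.
have r1 := ratio_ge1 R h.
by case: ifP => _; rewrite ?lexx ?ler01 ?r1 ?(le_trans ler01 r1).
Qed.

Lemma hweight_double (R : realFieldType) n z b : hweight R n z (2 * b)%N = hweight R n z b.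
Proof.
rewrite /hweight [LHS]big_seq [RHS]big_seq; apply: eq_bigr => p.
rewrite mem_primes_upto => /andP[pp _]; rewrite Euclid_dvdM // dvdn_prime2 //.
by rewrite /oddsmall; case: eqVneq => [->|].
Qed.

(* Telescoping over all integers in place of the primes. *)
Lemma hmax_le (R : realFieldType) n z : (1 < z)%N -> hmax R n z <= z%:R.
Proof.
move=> z1; rewrite /hmax big_filter.
pose g k : R := if (k < 3)%N then 1 else k%:R - 1.
have E m : \prod_(0 <= p < m.+1) (if oddsmall z p then ratio R p else 1) = g (minn m z).
  elim: m => [|m IH]; first by rewrite big_nat1 min0n.
  rewrite big_nat_recr //= IH /oddsmall; case: (ltnP m z) => mz; last first.
    by rewrite (minn_idPr (leqW mz)) andbF mulr1.
  rewrite (minn_idPl mz) andbT /g; have [m2|m2] := ltnP 1 m; last first.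
    have -> : (2 < m.+1)%N = false by lia.
    have -> : (m < 3)%N = true by lia.
    have -> : (m.+1 < 3)%N = true by lia.
    by rewrite mulr1.
  have m2' : 2 <= m%:R :> R by rewrite ler_nat.
  have -> : (2 < m.+1)%N = true by lia.
  have -> : (m.+1 < 3)%N = false by lia.
  rewrite /ratio -natr1; case: ltnP => m3.
    have -> : m = 2 by lia.
    by rewrite mul1r; field.
  have m3' : 3 <= m%:R :> R by rewrite ler_nat.
  by field; rewrite gt_eqF //; lra.
apply: le_trans (_ : \prod_(0 <= p < n.+1) (if oddsmall z p then ratio R p else 1) <= _).
  rewrite big_mkcond; apply: ler_prod => p _.
  case: (boolP (oddsmall z p)) => h; last by case: ifP; rewrite ler01 lexx.
  have r1 := ratio_ge1 R h; case: ifP => _; rewrite ?lexx ?ler01 ?r1 ?andbT //.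
  exact: le_trans r1.
rewrite E /g; case: ifP => _; first by rewrite ler1n ltnW.
rewrite lerBlDr ler_wpDr // ler_nat geq_minr //.
Qed.

(** Extended to all integers from 3 to [k], the product telescopes to [k / (2 (k - 1))]; the added
    factors are at most 1, so this is a lower bound. *)
Lemma kappa_prod_itv (R : realFieldType) n z : (1 < z)%N ->
  2^-1 <= kappa_prod R n z <= 1.
Proof.
move=> z1; apply/andP; split; last first.
  apply: prod_seq_le1 => p _.
  by case: ifP => [/(kappa_itv R)/andP[/ltW-> ->]|_]; rewrite ?ler01 ?lexx.
rewrite /kappa_prod big_filter.
pose g k : R := if (k < 3)%N then 1 else k%:R / (2 * (k%:R - 1)).
have E m : \prod_(0 <= p < m.+1) (if oddsmall z p then kappa R p else 1) = g (minn m z).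
  elim: m => [|m IH]; first by rewrite big_nat1 min0n.
  rewrite big_nat_recr //= IH /oddsmall; case: (ltnP m z) => mz; last first.
    by rewrite (minn_idPr (leqW mz)) andbF mulr1.
  rewrite (minn_idPl mz) andbT /g; have [m2|m2] := ltnP 1 m; last first.
    have -> : (2 < m.+1)%N = false by lia.
    have -> : (m < 3)%N = true by lia.
    have -> : (m.+1 < 3)%N = true by lia.
    by rewrite mulr1.
  have m2' : 2 <= m%:R :> R by rewrite ler_nat.
  have -> : (2 < m.+1)%N = true by lia.
  have -> : (m.+1 < 3)%N = false by lia.
  rewrite /kappa -natr1; case: ltnP => m3.
    have -> : m = 2 by lia.
    by rewrite mul1r; field.
  have m3' : 3 <= m%:R :> R by rewrite ler_nat.
  by field; rewrite !gt_eqF //; lra.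
apply: le_trans (_ : _ <= \prod_(0 <= p < n.+1) (if oddsmall z p then kappa R p else 1)) _.
  rewrite E /g; case: ltnP => k3; first lra.
  set k := minn n z in k3 *; have k3' : 3 <= k%:R :> R by rewrite ler_nat.
  by rewrite ler_pdivlMr; lra.
rewrite [leRHS]big_mkcond; apply: ler_prod => p _.
case: (boolP (oddsmall z p)) => [/(kappa_itv R)/andP[/ltW k0 k1]|h].
  by case: ifP => _; rewrite k0 ?lexx.
by case: ifP; rewrite ler01 lexx.
Qed.

Lemma norm_const_itv (R : realFieldType) n z : (1 < z)%N -> (0 < n)%N ->
  n%:R^-1 <= norm_const R n z <= 2 / n%:R.
Proof.
move=> z1 n0; have /andP[k1 k2] := kappa_prod_itv R n z1.
have n0' : 0 < 2 / n%:R :> R by rewrite divr_gt0 // ltr0n.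
rewrite /norm_const; apply/andP; split.
  have : 2 / n%:R * 2^-1 <= 2 / n%:R * kappa_prod R n z by rewrite ler_pM2l.
  by apply: le_trans; rewrite mulrAC divff ?mul1r ?pnatr_eq0.
by rewrite ler_piMr // ltW.
Qed.

Lemma sieve_weight_coprime (R : realFieldType) n z i j : (0 < i <= n)%N ->
  sieve_weight (primes_upto n) (coprime_weight R z i) j =
  if coprime i j then hweight R n z j else 0.
Proof.
move=> iN; rewrite (coprime_primes_upto j iN); case: ifPn => [/allP h|].
  rewrite /sieve_weight /hweight big_seq [in RHS]big_seq; apply: eq_bigr => p pP.
  have := h p pP; rewrite /coprime_weight; case: (p %| j)%N; last by rewrite !andbF.
  by rewrite andbT => /negPf->; rewrite andbT; case: ifP => _; ring.
rewrite -has_predC => /hasP[p pP /= /negPn/andP[pi pj]].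
rewrite /sieve_weight (bigD1_seq p) ?primes_upto_uniq //= pj /coprime_weight pi.
by rewrite subrr mul0r.
Qed.

Definition row_sum (R : realFieldType) (n z i : nat) : R :=
  \sum_(1 <= j < n.+1 | odd j != odd i) (if coprime i j then hweight R n z j else 0).

(** For odd [i] the partners are [j = 2 b] with [b <= n / 2], and the factor 2 affects neither the
    weight nor coprimality. For even [i] coprimality alone forces [j] to be odd. *)
Lemma row_sum_sieve (R : realFieldType) n z i : (0 < i <= n)%N ->
  row_sum R n z i =
  sieve_sum (primes_upto n) (coprime_weight R z i) (n %/ (if odd i then 2 else 1)).
Proof.
move=> iN; rewrite /sieve_sum; case: ifPn => oi.
  rewrite /row_sum oi (eq_bigl (fun j => 2 %| j)%N); last by move=> j; rewrite dvdn2; case: odd.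
  rewrite big_multiples //; apply: eq_bigr => b _.
  by rewrite sieve_weight_coprime // hweight_double coprimeMr coprimen2 oi.
rewrite divn1 /row_sum big_mkcond; apply: eq_bigr => j _.
rewrite sieve_weight_coprime // (negPf oi); case: (boolP (odd j)) => //= oj.
suff -> : coprime i j = false by [].
apply/negP => cij; have : (2 %| gcdn i j)%N by rewrite dvdn_gcd !dvdn2 oi oj.
by rewrite (eqP cij).
Qed.

Lemma large_part_itv (R : realFieldType) n z i : (0 < z)%N ->
  1 - (omega2 n i)%:R / z%:R <= large_part R n z i <= 1.
Proof.
move=> z0; have z0' : 0 < z%:R :> R by rewrite ltr0n.
have f01 p : 0 <= (if (z < p)%N && (p %| i)%N then 1 - p%:R^-1 else 1 : R) <= 1.
  case: ifP => [/andP[zp _]|_]; last by rewrite ler01 lexx.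
  have p0 : (0 < p)%N by lia.
  by rewrite subr_ge0 invf_le1 ?ltr0n // ler1n p0 lerBlDr lerDl invr_ge0 ler0n.
apply/andP; split; last by apply: prod_seq_le1 => p _; exact: f01.
have zN0 : z%:R != 0 :> R by rewrite gt_eqF.
rewrite /large_part /omega2.
elim: (primes_upto n) => [|p L IH].
  by rewrite !big_nil lerBlDr lerDl divr_ge0.
rewrite !big_cons natrM.
have P1 := @prod_seq_le1 R _ L _ (fun p _ => f01 p).
set P := \prod_(_ <- _) _ in IH P1 *; set W := (\prod_(_ <- _) _)%N in IH *.
have W1 : 1 <= W%:R :> R.
  rewrite ler1n /W; elim/big_ind: _ => // [x y x0 y0|q _]; first by rewrite muln_gt0 x0.
  by case: ifP.
case: (boolP (p %| i)%N) => pi; last by rewrite andbF !mul1r.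
case: ltnP => zp /=; last first.
  rewrite mul1r; apply: le_trans IH; rewrite lerD2l lerN2 ler_pM2r ?invr_gt0 //.
  by lra.
have pz : p%:R^-1 <= z%:R^-1 :> R by rewrite lef_pV2 ?posrE ?ltr0n ?ler_nat //; lia.
have zV0 : 0 < z%:R^-1 :> R by rewrite invr_gt0.
have pP : p%:R^-1 * P <= z%:R^-1 :> R.
  by apply: le_trans pz; rewrite ler_piMr // invr_ge0.
have : z%:R^-1 <= W%:R / z%:R :> R by rewrite ler_peMl // ltW.
rewrite mulrBl mul1r -mulrA; lra.
Qed.

(** Prime by prime: [ratio] and [kappa] make the factor at an odd [p <= z] equal to 1 whether or not
    [p] divides [i]. *)
Lemma main_term (R : realFieldType) n z i : (1 < z)%N -> (1 < n)%N -> (0 < i)%N ->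
  norm_const R n z * hweight R n z i *
    (n%:R / (if odd i then 2 else 1)%N%:R *
     \prod_(p <- primes_upto n) (1 + coprime_weight R z i p / p%:R)) =
  large_part R n z i.
Proof.
move=> z1 n1 i0; have n0 : n%:R != 0 :> R by rewrite pnatr_eq0; lia.
(* [c] collects the 2 of [norm_const] and the length of the interval; the product has the factor
   [c^-1] at [p = 2]. *)
pose c : R := if odd i then 1 else 2.
have cE : \prod_(p <- primes_upto n) (if p == 2%N then c^-1 else 1) = c^-1.
  rewrite (bigD1_seq 2%N) ?primes_upto_uniq ?mem_primes_upto //= big1 ?mulr1 //.
  by move=> p /negPf->.
have -> : norm_const R n z * hweight R n z i *
    (n%:R / (if odd i then 2 else 1)%N%:R *
     \prod_(p <- primes_upto n) (1 + coprime_weight R z i p / p%:R)) =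
   c * (kappa_prod R n z * hweight R n z i *
     \prod_(p <- primes_upto n) (1 + coprime_weight R z i p / p%:R)).
  by rewrite /norm_const /c; case: ifP => _; field.
have c0 : c != 0 by rewrite /c; case: ifP.
suff -> : kappa_prod R n z * hweight R n z i *
     \prod_(p <- primes_upto n) (1 + coprime_weight R z i p / p%:R) =
    c^-1 * large_part R n z i by rewrite mulVKf.
rewrite -cE -!big_split /= big_seq [in RHS]big_seq; apply: eq_bigr => p.
rewrite mem_primes_upto => /andP[pp _]; rewrite /coprime_weight /oddsmall /c.
have p2 := prime_gt1 pp.
have [->|pN2] := eqVneq p 2%N.
  rewrite /= (ltnNge z) z1 /= dvdn2 !mul1r mulr1; case: (odd i) => /=; first by rewrite mul0r addr0 invr1.
  by field.
have p3 : (2 < p)%N by rewrite ltn_neqAle eq_sym pN2.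
have p3' : 2 < p%:R :> R by rewrite ltr_nat.
rewrite p3 mul1r /= (ltnNge z) /ratio /kappa; case: (boolP (p <= z)%N) => pz;
  case: (p %| i)%N => /=; try by rewrite ?mul0r ?addr0 ?mulr1 ?mul1r ?mulN1r.
- by field; rewrite !gt_eqF //; lra.
- by field; rewrite !gt_eqF //; lra.
Qed.

Lemma prod_coprime_weight_le (R : realFieldType) n z i :
  \prod_(p <- primes_upto n) (1 + `|coprime_weight R z i p|) <=
  (omega2 n i)%:R * hmax R n z.
Proof.
rewrite /omega2 natr_prod /hmax -big_split /=.
apply: le_prod_seq => p _; rewrite addr_ge0 //= /coprime_weight.
case: ifP => _; case: (boolP (oddsmall z p)) => [/(ratio_ge1 R) r1|_];
  rewrite ?normrN1 ?normr0 ?ger0_norm ?subr_ge0 //; lra.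
Qed.

(** The first error comes from [large_part]. The second is the sieve error, at most [omega2 n i]
    times [hmax], multiplied by the row scaling; [hmax] enters twice, each time at most [z]. *)
Lemma row_sum_approx (R : realFieldType) n z i :
  (1 < z)%N -> (1 < n)%N -> (0 < i <= n)%N ->
  `|norm_const R n z * hweight R n z i * row_sum R n z i - 1| <=
  (omega2 n i)%:R / z%:R + 2 * z%:R ^+ 2 * (omega2 n i)%:R / n%:R.
Proof.
move=> z1 n1 /andP[i0 iN].
have z0 : (0 < z)%N by lia.
have n0 : (0 < n)%N by lia.
have /andP[K1 K2] := norm_const_itv R z1 n0.
have n0' : 0 < n%:R :> R by rewrite ltr0n.
have K0 : 0 <= norm_const R n z by apply: le_trans K1; rewrite invr_ge0.
have /andP[h1 h2] := hweight_itv R n z i.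
have hz := hmax_le R n z1.
have k0 : (0 < (if odd i then 2 else 1))%N by case: odd.
have := sieve_sum_approx (coprime_weight R z i) (primes_upto_uniq n) (primes_upto_prime n) n k0.
rewrite -row_sum_sieve ?i0 //.
move=> /le_trans/(_ (prod_coprime_weight_le R n z i)).
have := main_term R z1 n1 i0; have := large_part_itv R n i z0.
set M := (X in row_sum _ _ _ _ - X); set K := norm_const R n z * hweight R n z i.
set W : R := (omega2 n i)%:R; set S := row_sum R n z i.
move=> /andP[m1 m2] mE SM.
have K0' : 0 <= K by rewrite mulr_ge0 // (le_trans ler01).
have mE' : K * M = large_part R n z i := mE.
have -> : K * S - 1 = K * (S - M) + (large_part R n z i - 1) by rewrite -mE'; ring.
apply: le_trans (ler_normD _ _) _; rewrite addrC; apply: lerD.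
  by rewrite distrC ger0_norm ?subr_ge0 //; lra.
rewrite normrM (ger0_norm K0').
have W0 : 0 <= W by [].
have hm0 : 0 <= hmax R n z by rewrite (le_trans _ (le_trans h1 h2)).
have hi0 : 0 <= hweight R n z i by rewrite (le_trans _ h1).
apply: le_trans (_ : (2 / n%:R * z%:R) * (W * z%:R) <= _); last first.
  by rewrite le_eqVlt; apply/orP; left; apply/eqP; ring.
apply: ler_pM => //.
  by apply: ler_pM => //; apply: le_trans hz.
by apply: le_trans SM _; rewrite ler_wpM2l.
Qed.

(** * Common neighbours of two vertices *)

Lemma oddsmall0 p : oddsmall 0 p = false.
Proof. by rewrite /oddsmall leqn0 andbC; case: p. Qed.

Lemma hweight0 (R : realFieldType) n j : hweight R n 0 j = 1.
Proof. by rewrite /hweight big1 // => p _; rewrite oddsmall0. Qed.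

Lemma hmax0 (R : realFieldType) n : hmax R n 0 = 1.
Proof. by rewrite /hmax big1 // => p _; rewrite oddsmall0. Qed.

Lemma sieve_weight_coprime2 (R : realFieldType) n i i' j :
  (0 < i <= n)%N -> (0 < i' <= n)%N ->
  sieve_weight (primes_upto n) (coprime_weight R 0 (i * i')) j =
  if coprime i j && coprime i' j then 1 else 0.
Proof.
move=> iN iN'; have := sieve_weight_coprime R 0 j iN; have := sieve_weight_coprime R 0 j iN'.
rewrite !hweight0 => e' e.
transitivity (sieve_weight (primes_upto n) (coprime_weight R 0 i) j *
              sieve_weight (primes_upto n) (coprime_weight R 0 i') j).
  rewrite /sieve_weight -big_split [LHS]big_seq [RHS]big_seq; apply: eq_bigr => p /=.
  rewrite mem_primes_upto => /andP[pp _].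
  rewrite /coprime_weight oddsmall0 Euclid_dvdM //; case: (p %| j)%N; rewrite ?mulr1 //.
  by case: (p %| i)%N; case: (p %| i')%N => /=; ring.
by rewrite e e'; case: coprime; case: coprime; rewrite /= ?mulr1 ?mulr0.
Qed.

Lemma omega2M n i j : (omega2 n (i * j) <= omega2 n i * omega2 n j)%N.
Proof.
rewrite /omega2 -big_split /= big_seq [leqRHS]big_seq; apply: leq_prod => p.
rewrite mem_primes_upto => /andP[pp _]; rewrite Euclid_dvdM //.
by case: (p %| i)%N; case: (p %| j)%N.
Qed.

Definition common_count (R : realFieldType) (n i i' : nat) : R :=
  \sum_(1 <= j < n.+1 | odd j != odd i) (if coprime i j && coprime i' j then 1 else 0).

(** A prime dividing [i * i'] still leaves at least half of the integers, so the density is at least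
    [1 / W^2], and the sieve error is at most [W^2]. The 2 in the denominator allows for parity. *)
Lemma common_count_ge (R : realFieldType) n i i' (W : nat) :
  (0 < i <= n)%N -> (0 < i' <= n)%N -> odd i = odd i' ->
  (omega2 n i <= W)%N -> (omega2 n i' <= W)%N ->
  n%:R / (2 * W%:R ^+ 2) - W%:R ^+ 2 <= common_count R n i i'.
Proof.
move=> iN iN' oii' Wi Wi'.
set k := (if odd i then 2 else 1)%N.
have k0 : (0 < k)%N by rewrite /k; case: odd.
have -> : common_count R n i i' =
    sieve_sum (primes_upto n) (coprime_weight R 0 (i * i')) (n %/ k).
  rewrite /sieve_sum /k; case: ifPn => oi.
    rewrite /common_count oi (eq_bigl (fun j => 2 %| j)%N); last by move=> j; rewrite dvdn2; case: odd.
    rewrite big_multiples //; apply: eq_bigr => b _.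
    by rewrite sieve_weight_coprime2 // !coprimeMr !coprimen2 -oii' oi.
  rewrite divn1 /common_count big_mkcond; apply: eq_bigr => j _.
  rewrite sieve_weight_coprime2 // (negPf oi); case: (boolP (odd j)) => //= oj.
  suff -> : coprime i j = false by [].
  apply/negP => cij; have : (2 %| gcdn i j)%N by rewrite dvdn_gcd !dvdn2 oi oj.
  by rewrite (eqP cij).
have W2 : (omega2 n (i * i'))%:R <= W%:R ^+ 2 :> R.
  by rewrite -natrX ler_nat (leq_trans (omega2M n i i')) // -mulnn leq_mul.
have om0 : 0 < (omega2 n (i * i'))%:R :> R by rewrite ltr0n omega2_gt0.
have W20 : 0 < W%:R ^+ 2 :> R := lt_le_trans om0 W2.
have := sieve_sum_approx (coprime_weight R 0 (i * i')) (primes_upto_uniq n) (primes_upto_prime n) n k0.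
set S := sieve_sum _ _ _; set P := \prod_(_ <- _) (1 + _ / _).
have := prod_coprime_weight_le R n 0 (i * i'); rewrite hmax0 mulr1 => h1 /le_trans/(_ h1).
move=> /le_trans/(_ W2); rewrite ler_norml => /andP[h2 _].
have PW : (W%:R ^+ 2)^-1 <= P.
  apply: le_trans (_ : (omega2 n (i * i'))%:R^-1 <= _); first by rewrite lef_pV2.
  rewrite /omega2 natr_prod -prodfV; apply: le_prod_seq => p.
  rewrite mem_primes_upto => /andP[pp _]; rewrite invr_ge0 ler0n /coprime_weight /=.
  have p2 : 2 <= p%:R :> R by rewrite ler_nat prime_gt1.
  case: ifP => _; rewrite ?invr1.
    have : p%:R^-1 <= 2^-1 :> R by rewrite lef_pV2 ?posrE //; lra.
    by rewrite mulN1r; lra.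
  by rewrite oddsmall0 mul0r addr0.
have nk : n%:R / 2 <= n%:R / k%:R :> R.
  rewrite ler_wpM2l ?ler0n // lef_pV2 ?posrE ?ltr0n //.
  by rewrite /k; case: odd; rewrite ?ler_nat.
have : n%:R / 2 * (W%:R ^+ 2)^-1 <= n%:R / k%:R * P.
  by apply: ler_pM => //; rewrite ?divr_ge0 ?invr_ge0 ?ler0n // ltW.
by rewrite invfM mulrA; lra.
Qed.

(** * A doubly stochastic matrix on the coprimality graph *)

Lemma sum_off_zero (R : realFieldType) n (U : {pred 'I_n}) (f : 'I_n -> R) (M : R) :
  (forall j : 'I_n, (j \notin U) -> j = 0%N :> nat) -> 0 <= M ->
  (forall j, 0 <= f j <= M) ->
  \sum_j f j - M <= \sum_j (if j \in U then f j else 0) <= \sum_j f j.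
Proof.
move=> U0 M0 fM; apply/andP; split; last first.
  by apply: ler_sum => j _; case: ifP => // _; have /andP[] := fM j.
rewrite lerBlDr -lerBlDl -sumrB.
case: n U f U0 fM => [|n] U f U0 fM; first by rewrite big_ord0.
apply: le_trans (_ : \sum_(j < n.+1) (if j == ord0 then M else 0) <= _).
  apply: ler_sum => j _; case: ifPn => jU.
    by rewrite subrr; case: ifP.
  rewrite subr0 (_ : j = ord0) ?eqxx; last by apply/val_inj/U0.
  by have /andP[] := fM ord0.
by rewrite -big_mkcond big_pred1_eq.
Qed.

Lemma sum_ord_shift (R : nmodType) n (P : pred nat) (f : nat -> R) :
  \sum_(1 <= j < n.+1 | P j) f j = \sum_(j < n) (if P j.+1 then f j.+1 else 0).
Proof. by rewrite big_add1 /= big_mkcond big_mkord. Qed.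

Lemma card_odd_ord n : #|[pred i : 'I_n | odd i]| = n./2.
Proof.
rewrite -sum1_card (eq_bigl (fun i : 'I_n => odd i)) //.
rewrite -(big_mkord odd (fun=> 1%N)).
elim: n => [|n IH]; first by rewrite big_geq.
rewrite big_mkcond big_nat_recr //= -big_mkcond IH.
by case: ifP; lia.
Qed.

(* For odd [n] the vertex [0], i.e. the integer 1, is left out so that odd and
   even integers are equally many. *)
Definition active n : {pred 'I_n} := [pred i : 'I_n | odd n ==> (i != 0 :> nat)].
Arguments active : clear implicits.

Lemma card_active n :
  #|[pred i in active n | odd i]| = #|[pred i in active n | ~~ odd i]|.
Proof.
have c1 : #|[pred i in active n | odd i]| = n./2.
  rewrite -card_odd_ord; apply: eq_card => i; rewrite !inE.
  by case: (nat_of_ord i) => [|m] /=; rewrite ?andbF // implybT.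
have c2 : (#|[pred i : 'I_n | odd i]| + #|[pred i : 'I_n | ~~ odd i]| = n)%N.
  by rewrite -[RHS]card_ord -(cardC [pred i : 'I_n | odd i]).
have c3 : (#|[pred i in active n | ~~ odd i]| + odd n = #|[pred i : 'I_n | ~~ odd i]|)%N.
  case: n {c1 c2} => [|n]; first by rewrite !eq_card0 // => -[].
  rewrite [in RHS](cardD1 ord0) [in LHS](cardD1 ord0) !inE /= ?eqxx ?implybF ?negbK ?andbT.
  rewrite addnAC; congr (_ + _)%N; first by case: odd.
  apply: eq_card => i; rewrite !inE -(inj_eq val_inj) /=.
  by case: (nat_of_ord i == 0)%N; rewrite //= implybT.
move: c1 c2 c3; rewrite card_odd_ord; have := odd_double_half n; lia.
Qed.

(** [eps] is [8 * eta / o], where [o = 1 / (4 W^2)] bounds the overlap of two rows and [eta] is the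
    row error, enlarged to cover the omitted integer 1. That integer is fixed with entry 1, while
    its scaled entry is only known to be at least [1 / n]; hence the factor [n] in row 0. *)
Lemma coprime_doubly_stochastic (R : realFieldType) n z (W : nat) :
  (1 < z)%N -> (1 < n)%N ->
  (forall i, (0 < i <= n)%N -> (omega2 n i <= W)%N) ->
  (4 * W ^ 2 * (W ^ 2 + 1) <= n)%N ->
  let eps : R := 32 * W%:R ^+ 2 * (W%:R / z%:R + 4 * z%:R ^+ 2 * W%:R / n%:R) in
  eps <= 2^-1 ->
  exists B : 'I_n -> 'I_n -> R,
    [/\ forall i j, 0 <= B i j, forall i, \sum_j B i j = 1,
        forall j, \sum_i B i j = 1 &
        forall i j, B i j <= if coprime i.+1 j.+1 then
          norm_const R n z * hweight R n z i.+1 * hweight R n z j.+1 * (1 + eps) *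
            (if i == 0 :> nat then n%:R else 1) else 0].
Proof.
move=> z1 n1 omW nW eps eps2.
have n0 : (0 < n)%N by lia.
have n0' : 0 < n%:R :> R by rewrite ltr0n.
have z0' : 0 < z%:R :> R by rewrite ltr0n; lia.
have W1 : 1 <= W%:R :> R by rewrite ler1n; apply: leq_trans (omW 1%N _); rewrite ?omega2_gt0.
have /andP[K1 K2] := norm_const_itv R z1 n0.
set K := norm_const R n z in K1 K2 *; pose h i := hweight R n z i.
have K0 : 0 < K by apply: lt_le_trans K1; rewrite invr_gt0.
have h1 i : 1 <= h i by have /andP[] := hweight_itv R n z i.
have hz i : h i <= z%:R.
  by have /andP[_ h2] := hweight_itv R n z i; apply: le_trans h2 (hmax_le _ _ z1).
pose U := active n.
have U0 (j : 'I_n) : j \notin U -> j = 0%N :> nat.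
  by rewrite inE negb_imply negbK => /andP[_ /eqP].
pose cl (i : 'I_n) := odd i.
pose c (i j : 'I_n) : R :=
  if odd j.+1 != odd i.+1 then if coprime i.+1 j.+1 then K * h i.+1 * h j.+1 else 0 else 0.
pose b (i j : 'I_n) : R := if (i \in U) && (j \in U) then c i j else 0.
pose M : R := 2 * z%:R ^+ 2 / n%:R.
have M0 : 0 <= M by rewrite divr_ge0 ?mulr_ge0 ?exprn_ge0 // ltW.
have h0 i : 0 <= h i by apply: le_trans (h1 i).
have K0' := ltW K0.
have Kh_ge0 i j : 0 <= K * h i * h j by rewrite mulr_ge0 ?h0 // mulr_ge0 ?h0.
have KhM i j : 0 <= K * h i * h j <= M.
  rewrite Kh_ge0 (_ : M = 2 / n%:R * z%:R * z%:R); last by rewrite /M; ring.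
  by apply: ler_pM; rewrite ?hz ?h0 //; [apply: mulr_ge0|apply: ler_pM]; rewrite ?hz ?h0.
have cM i j : 0 <= c i j <= M.
  by rewrite /c; case: ifP => _; [case: ifP => _|]; rewrite ?KhM ?M0 ?lexx.
have c0 i j : 0 <= c i j by have /andP[] := cM i j.
pose eta : R := W%:R / z%:R + 4 * z%:R ^+ 2 * W%:R / n%:R.
pose o : R := (4 * W%:R ^+ 2)^-1.
have W20 : 0 < W%:R ^+ 2 :> R by rewrite exprn_gt0 // (lt_le_trans ltr01).
have o0 : 0 < o by rewrite invr_gt0 mulr_gt0.
have eoE : 8 * eta / o = eps by rewrite /o invrK /eps -/eta; ring.
have [||||||||B [B0 Bs Brow]] := @doubly_stochastic_correction R _ b cl U o eta.
- by move=> i j; rewrite /b; case: ifP.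
- move=> i j; rewrite /b andbC; case: ifP => // _; rewrite /c eq_sym coprime_sym.
  by case: ifP => // _; case: ifP => // _; ring.
- move=> i j; rewrite /b; case: ifP => [/andP[-> ->]|]; last by rewrite eqxx.
  rewrite /c /cl /= ; case: ifP => [|_]; last by rewrite eqxx.
  by rewrite eq_sym; case: odd; case: odd.
- move=> i iU.
  have -> : \sum_j b i j = \sum_j (if j \in U then c i j else 0).
    by apply: eq_bigr => j _; rewrite /b iU.
  have /andP[s1 s2] := sum_off_zero U0 M0 (cM i).
  have sc : \sum_j c i j = K * h i.+1 * row_sum R n z i.+1.
    rewrite /row_sum sum_ord_shift mulr_sumr; apply: eq_bigr => j _.
    rewrite /c; case: ifP => _; last by rewrite mulr0.
    by case: ifP => _; rewrite ?mulr0.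
  have iN : (0 < i.+1 <= n)%N by rewrite /= ltn_ord.
  have := row_sum_approx R z1 n1 iN; rewrite -/K -/(h i.+1) -sc => rs.
  have W2 : (omega2 n i.+1)%:R <= W%:R :> R by rewrite ler_nat omW.
  have {}rs : `|\sum_j c i j - 1| <= W%:R / z%:R + M * W%:R.
    apply: le_trans rs _; apply: lerD; first by rewrite ler_pM2r ?invr_gt0.
    rewrite [leLHS](_ : _ = M * (omega2 n i.+1)%:R); last by rewrite /M; ring.
    by rewrite ler_wpM2l.
  have MW : M <= M * W%:R by rewrite ler_peMr.
  have -> : eta = W%:R / z%:R + 2 * (M * W%:R) by rewrite /eta /M; ring.
  by move: rs; rewrite !ler_norml => /andP[? ?]; apply/andP; split; lra.
- have W21 : 1 <= W%:R ^+ 2 :> R by rewrite exprn_ege1.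
  by rewrite o0 /o invf_le1 ?mulr_gt0 //; lra.
- by rewrite eoE.
- move=> i i' iU iU' cii'.
  (* Every active common neighbour contributes at least [K], because [h >= 1]. The size condition on
     [n] makes the sieve error and the omitted vertex cost at most half of the main term. *)
  pose d (j : 'I_n) : R := if odd j.+1 != odd i.+1 then
    if coprime i.+1 j.+1 && coprime i'.+1 j.+1 then 1 else 0 else 0.
  apply: le_trans (_ : \sum_j (if j \in U then K * d j else 0) <= _); last first.
    apply: ler_sum => j _; rewrite /b iU iU' /=; case: ifP => _; last by rewrite minxx.
    rewrite /d /c; have -> : odd i'.+1 = odd i.+1 by move: cii'; rewrite /cl /= => ->.
    case: ifP => _; last by rewrite mulr0 minxx.
    have Kh x y : K <= K * h x * h y.
      by rewrite -mulrA ler_peMr ?(ltW K0) // -[1]mulr1 ler_pM.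
    by case: coprime; case: coprime; rewrite ?mulr1 ?mulr0 ?le_min ?lexx ?Kh ?Kh_ge0.
  have dK j : 0 <= K * d j <= K.
    by rewrite /d; case: ifP => _; [case: ifP => _|]; rewrite ?mulr1 ?mulr0 ?lexx ?(ltW K0).
  have /andP[s1 _] := sum_off_zero U0 (ltW K0) dK.
  apply: le_trans s1.
  have -> : \sum_j K * d j = K * common_count R n i.+1 i'.+1.
    by rewrite /common_count sum_ord_shift mulr_sumr.
  have iN : (0 < i.+1 <= n)%N by rewrite /= ltn_ord.
  have iN' : (0 < i'.+1 <= n)%N by rewrite /= ltn_ord.
  have oii' : odd i.+1 = odd i'.+1 by move: cii'; rewrite /cl /= => ->.
  have cc := common_count_ge R iN iN' oii' (omW _ iN) (omW _ iN').
  have nW' : 4 * W%:R ^+ 2 * (W%:R ^+ 2 + 1) <= n%:R :> R.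
    by move: nW; rewrite -(ler_nat R) !natrM natrD natrX.
  have nW2 : W%:R ^+ 2 + 1 <= n%:R / (4 * W%:R ^+ 2) :> R.
    by rewrite ler_pdivlMr; [rewrite mulrC|apply: mulr_gt0].
  have half : n%:R / (2 * W%:R ^+ 2) = 2 * (n%:R / (4 * W%:R ^+ 2)) :> R.
    by field; rewrite gt_eqF // (lt_le_trans ltr01).
  have : n%:R / (4 * W%:R ^+ 2) <= common_count R n i.+1 i'.+1 - 1 by lra.
  have -> : o = n%:R^-1 * (n%:R / (4 * W%:R ^+ 2)).
    by rewrite mulKf ?gt_eqF.
  have -> : K * common_count R n i.+1 i'.+1 - K = K * (common_count R n i.+1 i'.+1 - 1) by ring.
  by apply: ler_pM; rewrite ?invr_ge0 // divr_ge0 // mulr_ge0 // ltW.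
- exact: card_active.
exists (fun i j => if i \in U then B i j else (i == j)%:R); split.
- by move=> i j; case: ifP => // _; have /andP[] := B0 i j.
- move=> i; case: (boolP (i \in U)) => [iU|_]; first exact: Brow.
  by rewrite (bigD1 i) //= eqxx big1 ?addr0 // => j /negPf ji; rewrite eq_sym ji.
- move=> j; case: (boolP (j \in U)) => jU.
    rewrite -[RHS](Brow j jU); apply: eq_bigr => i _; rewrite Bs.
    case: ifPn => iU //; have := B0 j i; rewrite /b (negPf iU) andbF mul0r -eq_le => /eqP <-.
    by case: eqVneq iU => // ->; rewrite jU.
  rewrite (bigD1 j) //= (negPf jU) eqxx big1 ?addr0 // => i ij.
  case: ifPn => iU; last by rewrite (negPf ij).
  by apply/eqP; rewrite eq_le; have := B0 i j; rewrite /b (negPf jU) andbF mul0r andbC.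
- have eps0 : 0 <= eps.
    by rewrite /eps !(mulr_ge0, addr_ge0, divr_ge0, exprn_ge0) // ?ler0n.
  have n1' : 1 <= n%:R :> R by rewrite ler1n.
  move=> i j; case: ifPn => iU; last first.
    have i0 := U0 i iU; rewrite i0 eqxx coprime1n.
    apply: le_trans (_ : 1 <= _); first by rewrite lern1 leq_b1.
    apply: le_trans (_ : K * n%:R <= _); first by rewrite -ler_pdivrMr // mul1r.
    rewrite [leRHS](_ : _ = K * n%:R * (h 1%N * h j.+1 * (1 + eps))); last by rewrite /h; ring.
    rewrite ler_peMr ?(mulr_ge0 K0') // -[1]mulr1 ler_pM //; last by lra.
    by rewrite -[1]mulr1 ler_pM.
  have /andP[_ ] := B0 i j; rewrite eoE => /le_trans; apply.
  have big0 : 0 <= (if i == 0 :> nat then n%:R else 1 : R) by case: ifP.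
  have big1 : 1 <= (if i == 0 :> nat then n%:R else 1 : R) by case: ifP.
  have Kh0 : 0 <= K * h i.+1 * h j.+1 * (1 + eps).
    by rewrite mulr_ge0 ?Kh_ge0 // addr_ge0.
  rewrite /b; case: ifP => _.
    rewrite /c; case: ifP => _; case: ifP => // _; rewrite ?mul0r //.
      by rewrite ler_peMr.
    by rewrite mulr_ge0.
  by rewrite mul0r; case: ifP => // _; rewrite mulr_ge0.
Qed.

(** * The Euler product *)

(** The Euler factor is the inverse of the scaling per index at [p]: one [kappa], and [ratio] for
    the fraction 1/p of the rows and again of the columns. *)
Lemma ln_euler_factor (R : realType) p : (2 < p)%N ->
  0 < euler_factor R p /\
  ln (euler_factor R p) = - ln (kappa R p) - 2 / p%:R * ln (ratio R p).
Proof.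
move=> p2; have p2' : 2 < p%:R :> R by rewrite ltr_nat.
have p0 : 0 < p%:R :> R by lra.
have p10 : 0 < p%:R - 1 :> R by lra.
have p20 : 0 < p%:R - 2 :> R by lra.
have -> : euler_factor R p = (p%:R - 1) `^ (2 * (1 - p%:R^-1)) /
       (p%:R * (p%:R - 2) `^ (1 - 2 / p%:R)).
  by rewrite /euler_factor; case: eqVneq p2 => [->|].
have d0 : 0 < p%:R * (p%:R - 2) `^ (1 - 2 / p%:R) :> R by rewrite mulr_gt0 ?powR_gt0.
split; first by rewrite divr_gt0 ?powR_gt0.
rewrite ln_div ?posrE ?powR_gt0 // lnM ?posrE ?powR_gt0 // !ln_powR.
rewrite /kappa /ratio !ln_div ?posrE ?mulr_gt0 ?exprn_gt0 // lnM ?posrE // lnXn //.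
by field; rewrite gt_eqF.
Qed.

Lemma euler_factor_gt0 (R : realType) p : prime p -> 0 < euler_factor R p.
Proof.
move=> pp; have [->|p2] := eqVneq p 2%N; first by rewrite /euler_factor /= invr_gt0.
by have [] := @ln_euler_factor R p _; rewrite // ltn_neqAle eq_sym p2 prime_gt1.
Qed.

(** The terms of order 1/p in the lower bound for the logarithm cancel, leaving a deficit of order
    1/p^2 that is summable over the tail. *)
Lemma euler_factor_ge (R : realType) p : (2 < p)%N ->
  1 - 4 / p%:R ^+ 2 <= euler_factor R p.
Proof.
move=> p2; have [e0 eE] := ln_euler_factor R p2.
have p2' : 2 < p%:R :> R by rewrite ltr_nat.
have p0 : 0 < p%:R :> R by lra.
have p10 : 0 < p%:R - 1 :> R by lra.
have p20 : 0 < p%:R - 2 :> R by lra.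
have h1 : ln p%:R - ln (p%:R - 1) <= (p%:R - 1)^-1 :> R.
  rewrite -ln_div ?posrE // [X in ln X](_ : _ = 1 + (p%:R - 1)^-1); last first.
    by field; rewrite gt_eqF.
  by rewrite le_ln1Dx // (lt_trans (ltrN10 R)) ?invr_gt0.
have h2 : ln (p%:R - 2) - ln p%:R <= - (2 / p%:R) :> R.
  rewrite -ln_div ?posrE // [X in ln X](_ : _ = 1 - 2 / p%:R); last first.
    by field; rewrite gt_eqF.
  by rewrite le_ln1Dx // ltrN2 ltr_pdivrMr //; lra.
have lE : ln (euler_factor R p) =
    - (2 * (1 - p%:R^-1) * (ln p%:R - ln (p%:R - 1))) -
    (1 - 2 / p%:R) * (ln (p%:R - 2) - ln p%:R).
  rewrite eE /kappa /ratio !ln_div ?posrE ?mulr_gt0 ?exprn_gt0 // lnM ?posrE // lnXn //.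
  by field; rewrite gt_eqF.
have k1 : 2 * (1 - p%:R^-1) * (ln p%:R - ln (p%:R - 1)) <= 2 / p%:R :> R.
  apply: le_trans (_ : 2 * (1 - p%:R^-1) * (p%:R - 1)^-1 <= _).
    by rewrite ler_wpM2l // mulr_ge0 // subr_ge0 invf_le1 //; lra.
  by rewrite le_eqVlt; apply/orP; left; apply/eqP; field; rewrite !gt_eqF.
have k2 : (1 - 2 / p%:R) * (ln (p%:R - 2) - ln p%:R) <= (1 - 2 / p%:R) * - (2 / p%:R) :> R.
  by rewrite ler_wpM2l // subr_ge0 ler_pdivrMr //; lra.
have k3 : (1 - 2 / p%:R) * - (2 / p%:R) = - (2 / p%:R) + 4 / p%:R ^+ 2 :> R.
  by field; rewrite gt_eqF.
have : 1 + ln (euler_factor R p) <= euler_factor R p.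
  by rewrite -[leRHS]lnK ?posrE // expR_ge1Dx.
rewrite lE; lra.
Qed.

Lemma euler_partial_itv (R : realType) N : 0 < euler_partial R N <= 1.
Proof.
rewrite /euler_partial prodr_gt0 /=; last by move=> p; exact: euler_factor_gt0.
rewrite -big_filter; apply: prod_seq_le1 => p; rewrite mem_filter => /andP[pp _].
by rewrite euler_factor_le1 // ltW // euler_factor_gt0.
Qed.

Lemma euler_partialS (R : realType) N :
  euler_partial R N.+1 = euler_partial R N * (if prime N then euler_factor R N else 1).
Proof. by rewrite /euler_partial [LHS]big_mkcond [in RHS]big_mkcond big_nat_recr. Qed.

Lemma euler_product_itv (R : realType) z : (1 < z)%N ->
  euler_product R <= euler_partial R z.+1 <= euler_product R + 4 / z%:R.
Proof.
move=> z1; have cv := @is_cvg_euler_partial R; apply/andP; split.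
  apply: nonincreasing_cvgn_ge cv _.
  apply/nonincreasing_seqP => N; rewrite euler_partialS.
  have /andP[e0 _] := euler_partial_itv R N.
  by case: ifP => [pN|_]; rewrite ?mulr1 // ler_piMr ?euler_factor_le1 // ltW.
rewrite -lerBlDr.
have z0' : 0 < z%:R :> R by rewrite ltr0n; lia.
(* A loss of [4 / (N + 1)^2] is at most [4 (1 / N - 1 / (N + 1))], so the losses telescope even when
   taken over all integers. *)
have tail d : euler_partial R z.+1 - 4 * (z%:R^-1 - (z + d)%:R^-1) <=
    euler_partial R (z + d).+1.
  elim: d => [|d IH]; first by rewrite addn0 subrr mulr0 subr0.
  rewrite addnS [leRHS]euler_partialS; set N := (z + d)%N in IH *.
  have N0 : 0 < N%:R :> R by rewrite ltr0n /N; lia.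
  have N1E : N.+1%:R = N%:R + 1 :> R by rewrite natr1.
  have step : euler_partial R N.+1 - 4 / N.+1%:R ^+ 2 <=
      euler_partial R N.+1 * (if prime N.+1 then euler_factor R N.+1 else 1).
    have /andP[e0 e1] := euler_partial_itv R N.+1.
    case: ifP => _; last by rewrite mulr1 lerBlDr lerDl divr_ge0 // exprn_ge0.
    have N2 : (2 < N.+1)%N by rewrite /N; lia.
    have := euler_factor_ge R N2; rewrite -(ler_pM2l e0); apply: le_trans.
    rewrite mulrBr mulr1 lerD2l lerN2 ler_piMl // divr_ge0 // exprn_ge0 //.
  apply: le_trans step.
  have : 4 / N.+1%:R ^+ 2 <= 4 * (N%:R^-1 - N.+1%:R^-1) :> R.
    rewrite ler_pM2l // N1E.
    have -> : N%:R^-1 - (N%:R + 1)^-1 = (N%:R * (N%:R + 1))^-1 :> R.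
      by field; rewrite !gt_eqF //; lra.
    by rewrite lef_pV2 ?posrE ?mulr_gt0 ?exprn_gt0 //; nra.
  move: IH; set x := 4 / _; set u := N.+1%:R^-1; set v := N%:R^-1; set w := z%:R^-1.
  by lra.
apply: limr_ge cv _; near=> N.
have zN : (z < N)%N by near: N; exact: nbhs_infty_gt.
have := tail (N.-1 - z)%N; rewrite subnKC; last by lia.
rewrite prednK; last by lia.
apply: le_trans; rewrite lerD2l lerN2 ler_pM2l // lerBlDr lerDl invr_ge0 ler0n.
by [].
Unshelve. all: by end_near. Qed.

Lemma big_primes_upto (R : nmodType) n (f : nat -> R) :
  \sum_(p <- primes_upto n) f p = \sum_(0 <= p < n.+1 | prime p) f p.
Proof. by rewrite big_filter. Qed.

Lemma ln_euler_partial (R : realType) n z : (1 < z <= n)%N ->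
  ln (euler_partial R z.+1) = - ln 2 -
    \sum_(p <- primes_upto n) (if oddsmall z p then
       ln (kappa R p) + 2 / p%:R * ln (ratio R p) else 0).
Proof.
move=> /andP[z1 zn]; rewrite ln_prod; last by move=> p; exact: euler_factor_gt0.
have -> : \sum_(0 <= p < z.+1 | prime p) ln (euler_factor R p) =
    \sum_(p <- primes_upto n) (if (p <= z)%N then ln (euler_factor R p) else 0).
  rewrite big_primes_upto (@big_cat_nat _ _ _ z.+1 0 n.+1) //=.
  rewrite [X in _ + X]big_nat_cond [X in _ + X]big1 ?addr0; last first.
    by move=> p /andP[/andP[zp _] _]; rewrite leqNgt zp.
  rewrite big_nat_cond [in RHS]big_nat_cond; apply: eq_bigr => p.
  by rewrite ltnS => /andP[/andP[_ ->]].
have P2 : 2%N \in primes_upto n by rewrite mem_primes_upto /=; lia.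
rewrite (bigD1_seq 2%N) ?primes_upto_uniq //= z1 [in RHS](bigD1_seq 2%N) ?primes_upto_uniq //=.
rewrite add0r /euler_factor /= lnV ?posrE //.
congr (_ + _); rewrite -sumrN [LHS]big_seq_cond [RHS]big_seq_cond; apply: eq_bigr => p.
rewrite mem_primes_upto => /andP[/andP[pp _] p2].
have p3 : (2 < p)%N by rewrite ltn_neqAle eq_sym p2 prime_gt1.
rewrite /oddsmall p3 /=; case: ifP => _; last by rewrite oppr0.
by have [_] := ln_euler_factor R p3; rewrite /euler_factor => ->; rewrite opprD.
Qed.

Lemma ln_kappa_prod (R : realType) n z :
  ln (kappa_prod R n z) = \sum_(p <- primes_upto n) (if oddsmall z p then ln (kappa R p) else 0).
Proof.
rewrite ln_prod; last by move=> p _; case: ifP => // /(kappa_itv R)/andP[].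
by apply: eq_bigr => p _; case: ifP => // _; rewrite ln1.
Qed.

Lemma ln_hmax (R : realType) n z :
  ln (hmax R n z) = \sum_(p <- primes_upto n) (if oddsmall z p then ln (ratio R p) else 0).
Proof.
rewrite ln_prod; last by move=> p _; case: ifP => // /(ratio_ge1 R); apply: lt_le_trans.
by apply: eq_bigr => p _; case: ifP => // _; rewrite ln1.
Qed.

Lemma sum_ln_hweight (R : realType) n z :
  \sum_(i < n) ln (hweight R n z i.+1) =
  \sum_(p <- primes_upto n) (if oddsmall z p then (n %/ p)%:R * ln (ratio R p) else 0).
Proof.
transitivity (\sum_(i < n) \sum_(p <- primes_upto n)
    (if oddsmall z p && (p %| i.+1)%N then ln (ratio R p) else 0)).
  apply: eq_bigr => i _; rewrite ln_prod.
    by apply: eq_bigr => p _; case: ifP => // _; rewrite ln1.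
  by move=> p _; case: ifP => // /andP[/(ratio_ge1 R) r1 _]; apply: lt_le_trans r1.
rewrite exchange_big /= big_seq [RHS]big_seq; apply: eq_bigr => p.
rewrite mem_primes_upto => /andP[pp _]; case: ifP => os; last by rewrite big1.
rewrite -(@sum_ord_shift R n (fun i => (p %| i)%N) (fun=> ln (ratio R p))).
rewrite big_multiples ?prime_gt0 // sumr_const_nat subSS subn0 mulr_natl //.
Qed.

(** [S] is the logarithm of the total scaling. Replacing [n / p] by the actual number of multiples
    costs at most [ln (ratio R p)] per prime, in all at most [ln z], and the 2 in [norm_const]
    matches the Euler factor 1/2 at [p = 2]. *)
Lemma log_balance (R : realType) n z : (1 < z <= n)%N ->
  let S := n%:R * ln (norm_const R n z) + 2 * \sum_(i < n) ln (hweight R n z i.+1) in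
  n%:R * ln n%:R + n%:R * ln (euler_partial R z.+1) <= - S <=
  n%:R * ln n%:R + n%:R * ln (euler_partial R z.+1) + 2 * ln z%:R.
Proof.
move=> zn; have /andP[z1 zn'] := zn; have n0 : 0 < n%:R :> R by rewrite ltr0n; lia.
have /andP[k1 k2] := kappa_prod_itv R n z1.
have k0 : 0 < kappa_prod R n z by apply: lt_le_trans k1; rewrite invr_gt0.
rewrite /= (ln_euler_partial R zn) sum_ln_hweight /norm_const.
rewrite lnM ?posrE ?divr_gt0 // ln_div ?posrE // ln_kappa_prod.
have -> : \sum_(p <- primes_upto n) (if oddsmall z p then
       ln (kappa R p) + 2 / p%:R * ln (ratio R p) else 0) =
   \sum_(p <- primes_upto n) (if oddsmall z p then ln (kappa R p) else 0) +
   2 * \sum_(p <- primes_upto n) (if oddsmall z p then p%:R^-1 * ln (ratio R p) else 0).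
  rewrite mulr_sumr -big_split; apply: eq_bigr => p _ /=.
  by case: ifP => _; ring.
set A := \sum_(p <- _) (if _ then ln (kappa R p) else 0).
set B := \sum_(p <- _) (if _ then p%:R^-1 * _ else 0).
set H := \sum_(p <- _) (if _ then (n %/ p)%:R * _ else 0).
have lnr p : oddsmall z p -> 0 <= ln (ratio R p) by move=> /(ratio_ge1 R); apply: ln_ge0.
have HB : H <= n%:R * B.
  rewrite /H /B mulr_sumr big_seq [leRHS]big_seq; apply: ler_sum => p.
  rewrite mem_primes_upto => /andP[pp _]; case: ifP => os; last by rewrite mulr0.
  have p0 : 0 < p%:R :> R by rewrite ltr0n prime_gt0.
  by rewrite mulrA ler_wpM2r ?lnr // ler_pdivlMr // -natrM ler_nat leq_trunc_div.
have BH : n%:R * B <= H + ln z%:R.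
  apply: le_trans (_ : _ <= H + ln (hmax R n z)) _; last first.
    rewrite lerD2l ler_ln ?posrE ?hmax_le //; last by rewrite ltr0n; lia.
    by have /andP[h1 h2] := hweight_itv R n z 0; rewrite (lt_le_trans ltr01) // (le_trans h1).
  rewrite ln_hmax /H /B mulr_sumr -big_split /= big_seq [leRHS]big_seq; apply: ler_sum => p.
  rewrite mem_primes_upto => /andP[pp _]; case: ifP => os; last by rewrite mulr0 addr0.
  have p0 : 0 < p%:R :> R by rewrite ltr0n prime_gt0.
  rewrite mulrA -[X in _ + X]mul1r -mulrDl ler_wpM2r ?lnr // ler_pdivrMr // natr1 -natrM.
  by rewrite ler_nat ltnW // ltn_ceil // prime_gt0.
apply/andP; split; lra.
Qed.

Lemma ln_fact_itv (R : realType) n : (0 < n)%N ->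
  n%:R * ln n%:R - n%:R <= ln (n`!%:R : R) <= n%:R * ln n%:R - n%:R + ln n%:R + 1.
Proof.
case: n => // n _; elim: n => [|n /andP[IH1 IH2]].
  have -> : 1`!%:R = 1 :> R by [].
  by rewrite ln1 mulr0; apply/andP; split; lra.
set N := n.+1 in IH1 IH2 *.
have N0 : 0 < N%:R :> R by rewrite ltr0n.
have N1E : N.+1%:R = N%:R + 1 :> R by rewrite natr1.
have N1 : 0 < N.+1%:R :> R by rewrite ltr0n.
rewrite factS natrM lnM ?posrE ?ltr0n ?fact_gt0 //.
have h1 : N%:R * (ln N.+1%:R - ln N%:R) <= 1 :> R.
  rewrite -ln_div ?posrE // -[leRHS](@divff _ N%:R) ?gt_eqF // ler_pM2l //.
  rewrite [X in ln X](_ : _ = 1 + N%:R^-1); last by rewrite N1E; field; rewrite gt_eqF.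
  by rewrite le_ln1Dx // (lt_trans (ltrN10 R)) ?invr_gt0.
have h2 : N.+1%:R * (ln N%:R - ln N.+1%:R) <= - 1 :> R.
  rewrite -ln_div ?posrE //.
  have : ln (N%:R / N.+1%:R) <= - N.+1%:R^-1 :> R.
    rewrite [X in ln X](_ : _ = 1 + - N.+1%:R^-1); last by rewrite N1E; field; rewrite gt_eqF; lra.
    by rewrite le_ln1Dx // ltrN2 invf_lt1 // ltr1n.
  rewrite -(ler_pM2l N1) => /le_trans; apply.
  by rewrite mulrN divff // gt_eqF.
move: h1 h2; rewrite N1E => h1 h2; apply/andP; split; lra.
Qed.

(** * Bounds for the number of coprime permutations *)

Definition coprime_mx (R : realFieldType) n (i j : 'I_n) : R :=
  if coprime i.+1 j.+1 then 1 else 0.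

Lemma coprime_perm_count_permanent (R : realFieldType) n :
  (coprime_perm_count n)%:R = permanent (@coprime_mx R n).
Proof.
rewrite /coprime_perm_count /permanent -sum1_card natr_sum big_mkcond /=.
apply: eq_bigr => s _; rewrite inE /coprime_perm; case: ifPn => [/forallP h|].
  by rewrite big1 // => i _; rewrite /coprime_mx h.
rewrite negb_forall => /existsP[i ni].
by rewrite (bigD1 i) //= /coprime_mx (negPf ni) mul0r.
Qed.

(** The doubly stochastic matrix is entrywise at most the coprimality matrix with rows scaled by
    [rw] and columns by [hweight]. Dividing out the scaling, which [log_balance] evaluates, turns
    [exp(-n)] into a bound for the count. *)
Lemma ln_count_lower (R : realType) n z (W : nat) :
  (1 < z <= n)%N ->
  (forall i, (0 < i <= n)%N -> (omega2 n i <= W)%N) ->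
  (4 * W ^ 2 * (W ^ 2 + 1) <= n)%N ->
  let eps : R := 32 * W%:R ^+ 2 * (W%:R / z%:R + 4 * z%:R ^+ 2 * W%:R / n%:R) in
  eps <= 2^-1 ->
  0 < (coprime_perm_count n)%:R :> R /\
  n%:R * ln n%:R + n%:R * ln (euler_partial R z.+1) - n%:R - ln n%:R - n%:R * eps <=
    ln (coprime_perm_count n)%:R.
Proof.
move=> zn omW nW eps eps2; have /andP[z1 zn'] := zn.
have n1 : (1 < n)%N by lia.
have n0 : 0 < n%:R :> R by rewrite ltr0n; lia.
have [B [B0 Br Bc Bh]] := @coprime_doubly_stochastic R n z W z1 n1 omW nW eps2.
have eps0 : 0 <= eps.
  by rewrite /eps !(mulr_ge0, addr_ge0, divr_ge0, exprn_ge0) // ?ler0n.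
have /andP[K1 _] := norm_const_itv R z1 (ltnW n1).
have [K KE] : exists K, K = norm_const R n z by eexists.
rewrite -KE in K1 Bh.
have K0 : 0 < K by apply: lt_le_trans K1; rewrite invr_gt0.
have h0 i : 0 < hweight R n z i.
  by have /andP[h1 _] := hweight_itv R n z i; apply: lt_le_trans h1.
pose rw (i : 'I_n) : R :=
  K * (1 + eps) * hweight R n z i.+1 * (if i == 0 :> nat then n%:R else 1).
have e10 : 0 < 1 + eps by rewrite ltr_wpDr.
have rw0 i : 0 < rw i by rewrite /rw !mulr_gt0 //; case: (_ == _).
have perB := permanent_doubly_stochastic B0 Br Bc.
have le1 : permanent B <= \prod_i rw i *
    (permanent (@coprime_mx R n) * \prod_(i < n) hweight R n z i.+1).
  rewrite -permanent_scale_col -permanent_scale_row; apply: le_permanent => i j.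
  rewrite B0 /=; apply: le_trans (Bh i j) _; rewrite /coprime_mx.
  case: ifP => _; last by rewrite mul0r mulr0.
  by rewrite -/eps mul1r /rw le_eqVlt; apply/orP; left; apply/eqP; ring.
have prw0 : 0 < \prod_i rw i by apply: prodr_gt0.
have ph0 : 0 < \prod_(i < n) hweight R n z i.+1 by apply: prodr_gt0.
rewrite -coprime_perm_count_permanent in le1.
have C0 : 0 < (coprime_perm_count n)%:R :> R.
  have := lt_le_trans (expR_gt0 _) (le_trans perB le1).
  by rewrite pmulr_rgt0 // pmulr_lgt0.
split => //.
have := le_trans perB le1; rewrite -ler_ln ?posrE ?expR_gt0 ?mulr_gt0 // expRK.
rewrite lnM ?posrE ?mulr_gt0 // lnM ?posrE // ln_prod // ln_prod //.
have -> : \sum_i ln (rw i) =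
    n%:R * ln K + n%:R * ln (1 + eps) + \sum_(i < n) ln (hweight R n z i.+1) + ln n%:R.
  rewrite (eq_bigr (fun i : 'I_n => (ln K + ln (1 + eps)) +
      ln (hweight R n z i.+1) + (if i == 0 :> nat then ln n%:R else 0))); last first.
    move=> i _; rewrite /rw lnM ?posrE ?mulr_gt0 //; last by case: ifP.
    rewrite lnM ?posrE ?mulr_gt0 // lnM ?posrE //.
    by case: ifP => _; rewrite ?ln1.
  rewrite !big_split /= !sumr_const card_ord -[ln K *+ _]mulr_natl.
  rewrite -[ln (1 + eps) *+ _]mulr_natl; congr (_ + _).
  case: (n) n1 => // m _; rewrite (bigD1 ord0) //= big1 ?addr0 // => i.
  by rewrite -(inj_eq val_inj) /= => /negPf->.
have /andP[lb _] := log_balance R zn; move: lb; rewrite /= -KE => lb.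
have : n%:R * ln (1 + eps) <= n%:R * eps.
  by rewrite ler_pM2l // le_ln1Dx // (lt_le_trans _ eps0).
lra.
Qed.

Lemma sum_alternating (R : zmodType) n (a : R) :
  \sum_(i < n) (if odd i.+1 then - a else a) = if odd n then - a else 0.
Proof.
elim: n => [|n IH]; first by rewrite big_ord0.
rewrite big_ord_recr /= IH; case: (odd n) => /=; first by rewrite addNr.
by rewrite add0r.
Qed.

(* Odd integers get weight [1/n] and even ones weight [n]; this makes the
   odd-odd entries negligible in the row sums and costs a factor [n^2]. *)
Lemma ln_count_upper (R : realType) n z (W : nat) (theta : R) :
  (1 < z <= n)%N -> 0 < theta < 1 ->
  (forall i, (0 < i <= n)%N -> (omega2 n i <= W)%N) ->
  let eta : R := W%:R / z%:R + 4 * z%:R ^+ 2 * W%:R / n%:R in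
  eta <= 1 ->
  0 < (coprime_perm_count n)%:R :> R ->
  ln (coprime_perm_count n)%:R <=
  n%:R * ln n%:R + n%:R * ln (euler_partial R z.+1) - n%:R +
  n%:R * (eta + 2 * z%:R ^+ 2 / n%:R / theta + 3 * theta) +
  2 * ln z%:R + 2 * ln n%:R.
Proof.
move=> zn th omW eta eta1 C0; have /andP[z1 zn'] := zn.
have /andP[t0 t1] := th.
have n1 : (1 < n)%N by lia.
have n0 : 0 < n%:R :> R by rewrite ltr0n; lia.
have z0 : 0 < z%:R :> R by rewrite ltr0n; lia.
have W1 : 1 <= W%:R :> R.
  by rewrite ler1n; apply: leq_trans (omW 1%N _); rewrite ?omega2_gt0 //; lia.
have /andP[K1 K2] := norm_const_itv R z1 (ltnW n1).
have [K KE] : exists K, K = norm_const R n z by eexists.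
rewrite -KE in K1 K2.
have K0 : 0 < K by apply: lt_le_trans K1; rewrite invr_gt0.
pose h i := hweight R n z i.
have h1 i : 1 <= h i by have /andP[] := hweight_itv R n z i.
have h0 i : 0 < h i by apply: lt_le_trans (h1 i).
have hz i : h i <= z%:R.
  by have /andP[_ h2] := hweight_itv R n z i; apply: le_trans h2 (hmax_le _ _ z1).
pose M : R := 2 * z%:R ^+ 2 / n%:R.
have M0 : 0 < M by rewrite divr_gt0 ?mulr_gt0 ?exprn_gt0.
have Kh_ge0 i j : 0 <= K * h i * h j.
  by rewrite mulr_ge0 ?(ltW (h0 _)) // mulr_ge0 ?(ltW (h0 _)) ?(ltW K0).
have KhM i j : K * h i * h j <= M.
  rewrite (_ : M = 2 / n%:R * z%:R * z%:R); last by rewrite /M; ring.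
  have ? := ltW (h0 i); have ? := ltW (h0 j); have ? := ltW K0.
  by apply: ler_pM; rewrite ?hz //; [apply: mulr_ge0|apply: ler_pM; rewrite ?hz].
pose d i : R := if odd i then n%:R^-1 else n%:R.
have d0 i : 0 < d i by rewrite /d; case: ifP; rewrite ?invr_gt0.
have nV1 : n%:R^-1 <= 1 :> R by rewrite invf_le1 // ler1n ltnW.
pose b (i j : 'I_n) : R :=
  K * (h i.+1 * d i.+1) * (@coprime_mx R n i j * (h j.+1 * d j.+1)).
pose c (i j : 'I_n) : R :=
  if odd j.+1 != odd i.+1 then if coprime i.+1 j.+1 then K * h i.+1 * h j.+1 else 0 else 0.
have bE i j : b i j = K * h i.+1 * h j.+1 * (@coprime_mx R n i j * (d i.+1 * d j.+1)).
  by rewrite /b; ring.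
have b0 i j : 0 <= b i j.
  rewrite bE mulr_ge0 ?Kh_ge0 // mulr_ge0 ?mulr_ge0 ?(ltW (d0 _)) //.
  by rewrite /coprime_mx; case: ifP.
have bcase i j : b i j <= M /\ b i j <= c i j + M / n%:R.
  have Mn0 : 0 <= M / n%:R by rewrite divr_ge0 ?ltW.
  rewrite bE /c /coprime_mx /d; case: (boolP (coprime i.+1 j.+1)) => cij; last first.
    by rewrite mul0r mulr0 if_same add0r Mn0 ltW.
  rewrite mul1r.
  (* Odd-odd entries carry the factor [1 / n^2], so a row of them sums to at most [M]; for mixed
     parity the factors [d] cancel, and two even integers are not coprime. *)
  case: (boolP (odd i.+1)) => oi; case: (boolP (odd j.+1)) => oj /=.
  - have kM : K * h i.+1 * h j.+1 * (n%:R^-1 * n%:R^-1) <= M / n%:R.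
      rewrite mulrA ler_pM2r ?invr_gt0 //; apply: le_trans (KhM i.+1 j.+1).
      by rewrite ler_piMr.
    rewrite add0r; split => //; apply: le_trans kM _.
    by rewrite ler_piMr // ltW.
  - by rewrite mulVf ?gt_eqF // mulr1 lerDl; split.
  - by rewrite divff ?gt_eqF // mulr1 lerDl; split.
  - have : (2 %| gcdn i.+1 j.+1)%N by rewrite dvdn_gcd !dvdn2 oi oj.
    by rewrite (eqP cij).
have row i : \sum_j b i j <= 1 + eta.
  apply: le_trans (_ : \sum_(j < n) (c i j + M / n%:R) <= _).
    by apply: ler_sum => j _; have [] := bcase i j.
  rewrite big_split /= sumr_const card_ord -[(M / n%:R) *+ _]mulr_natr mulfVK ?gt_eqF //.
  have -> : \sum_j c i j = K * h i.+1 * row_sum R n z i.+1.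
    rewrite /row_sum sum_ord_shift mulr_sumr; apply: eq_bigr => j _.
    rewrite /c; case: ifP => _; last by rewrite mulr0.
    by case: ifP => _; rewrite ?mulr0.
  have iN : (0 < i.+1 <= n)%N by rewrite /= ltn_ord.
  have := row_sum_approx R z1 n1 iN; rewrite -KE -/(h i.+1) ler_norml => /andP[_].
  have W2 : (omega2 n i.+1)%:R <= W%:R :> R by rewrite ler_nat omW.
  have w1 : (omega2 n i.+1)%:R / z%:R <= W%:R / z%:R :> R by rewrite ler_pM2r ?invr_gt0.
  have w2 : 2 * z%:R ^+ 2 * (omega2 n i.+1)%:R / n%:R <= M * W%:R.
    rewrite [leLHS](_ : _ = M * (omega2 n i.+1)%:R); last by rewrite /M; ring.
    by rewrite ler_pM2l.
  have MW : M <= M * W%:R by rewrite ler_peMr // ltW.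
  have -> : eta = W%:R / z%:R + 2 * (M * W%:R) by rewrite /eta /M; ring.
  lra.
have eta0 : 0 <= eta.
  by rewrite /eta !(mulr_ge0, addr_ge0, divr_ge0, exprn_ge0) // ?ler0n.
have up : permanent b <= expR (\sum_i row_bound M theta 2 (\sum_j b i j)).
  apply: permanent_small_entries => // [i j|i].
    by rewrite b0; have [] := bcase i j.
  by apply: le_trans (row i) _; lra.
have rb i : row_bound M theta 2 (\sum_j b i j) <= - 1 + (eta + M / theta + 3 * theta).
  rewrite /row_bound; set r := \sum_j b i j.
  have r0 : 0 <= r by apply: sumr_ge0.
  have Mt0 : 0 < M / theta by rewrite divr_gt0.
  have l1 : ln (r + M / theta) <= eta + M / theta.
    apply: le_trans (_ : ln (1 + (eta + M / theta)) <= _).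
      by rewrite ler_ln ?posrE; have := row i; rewrite -/r; lra.
    by rewrite le_ln1Dx //; lra.
  have l2 : (1 - theta) * ln (r + M / theta) <= (1 - theta) * (eta + M / theta).
    by rewrite ler_wpM2l // subr_ge0 ltW.
  have l3 : (1 - theta) * (eta + M / theta) <= eta + M / theta.
    by rewrite ler_piMl //; lra.
  have l4 : ln 2 <= 1 :> R.
    by have := @le_ln1Dx R 1; rewrite (_ : 1 + 1 = 2); [apply; lra|ring].
  have l5 : theta * ln 2 <= theta by rewrite ler_piMr // ltW.
  lra.
have up2 : permanent b <= expR (n%:R * (- 1 + (eta + M / theta + 3 * theta))).
  apply: le_trans up _; rewrite ler_expR.
  apply: le_trans (ler_sum _ (fun i _ => rb i)) _.
  by rewrite sumr_const card_ord -[leLHS]mulr_natl.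
have perb : permanent b = \prod_(i < n) (K * (h i.+1 * d i.+1)) *
    ((coprime_perm_count n)%:R * \prod_(i < n) (h i.+1 * d i.+1)).
  by rewrite coprime_perm_count_permanent -permanent_scale_col -permanent_scale_row.
have hd0 i : 0 < h i * d i by rewrite mulr_gt0.
have Khd0 i : 0 < K * (h i * d i) by rewrite mulr_gt0.
have p1 : 0 < \prod_(i < n) (h i.+1 * d i.+1) by apply: prodr_gt0.
have p2 : 0 < \prod_(i < n) (K * (h i.+1 * d i.+1)) by apply: prodr_gt0.
have perb0 : 0 < permanent b by rewrite perb mulr_gt0 // mulr_gt0.
have : ln (permanent b) <= n%:R * (- 1 + (eta + M / theta + 3 * theta)).
  by rewrite -ler_expR lnK.
rewrite perb lnM ?posrE ?mulr_gt0 // lnM ?posrE // ln_prod // ln_prod //.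
pose S' : R := \sum_(i < n) ln (hweight R n z i.+1).
(* Consecutive factors [1 / n] and [n] cancel in pairs; an odd [n] leaves one [1 / n] for the rows
   and one for the columns. *)
pose alt : R := if odd n then - ln n%:R else 0.
have sd : \sum_(i < n) ln (h i.+1 * d i.+1) = S' + alt.
  rewrite /S' /alt -sum_alternating -big_split; apply: eq_bigr => i _ /=.
  rewrite lnM ?posrE // /d /=; congr (_ + _).
  by case: (odd i); rewrite //= lnV ?posrE.
have -> : \sum_(i < n) ln (K * (h i.+1 * d i.+1)) =
    n%:R * ln K + \sum_(i < n) ln (h i.+1 * d i.+1).
  rewrite (eq_bigr (fun i : 'I_n => ln K + ln (h i.+1 * d i.+1))).
    by rewrite big_split /= sumr_const card_ord -[ln K *+ _]mulr_natl.
  by move=> i _; rewrite lnM ?posrE.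
rewrite sd; have /andP[_] := log_balance R zn; rewrite /= -KE -/S'.
have ln0 : 0 <= ln n%:R :> R by rewrite ln_ge0 // ler1n ltnW.
have : - ln n%:R <= alt by rewrite /alt; case: ifP => // _; rewrite oppr_le0.
rewrite -/M; lra.
Qed.

(** * Choice of parameters and conclusion *)

Lemma root_floor K n : (0 < K)%N -> (0 < n)%N ->
  exists q, [/\ (0 < q)%N, (q ^ K <= n)%N & (n < q.+1 ^ K)%N].
Proof.
move=> K0 n0; have ex : exists q, (q ^ K <= n)%N by exists 1%N; rewrite exp1n.
have ub q : (q ^ K <= n)%N -> (q <= n)%N.
  apply: leq_trans; case: q => // q; rewrite -{1}[q.+1]expn1 leq_pexp2l //.
case: (ex_maxnP ex ub) => q qn qmax; exists q; split => //.
  by apply: qmax; rewrite exp1n.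
by rewrite ltnNge; apply/negP => /qmax; rewrite ltnn.
Qed.

Lemma omega2_root K : (0 < K)%N -> exists2 C, (0 < C)%N &
  forall n i q, (0 < i <= n)%N -> (0 < q)%N -> (n < q.+1 ^ K)%N ->
    (omega2 n i <= C * q)%N.
Proof.
move=> K0; set M := ((2 ^ K) ^ (2 ^ K))%N.
have M0 : (0 < M)%N by rewrite !expn_gt0.
exists (M * 2)%N; first by rewrite muln_gt0 M0.
move=> n i q /andP[i0 iN] q0 nq; rewrite -(leq_exp2r _ _ K0).
apply: leq_trans (omega2_bound K n i0) _; rewrite -/M -mulnA expnMn leq_mul //.
  by rewrite -{1}[M]expn1 leq_pexp2l.
apply: leq_trans iN _; apply: leq_trans (ltnW nq) _.
by rewrite leq_exp2r //; lia.
Qed.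

Lemma expR_le1D2 (R : realType) (t : R) : 0 <= t <= 2^-1 -> expR t <= 1 + 2 * t.
Proof.
move=> /andP[t0 t1]; have := expR_ge1Dx (- t); rewrite expRN => h.
have e0 := expR_gt0 t.
rewrite -(ler_pM2r (_ : 0 < (expR t)^-1)) ?invr_gt0 // divff ?gt_eqF //.
by apply: le_trans (_ : (1 + 2 * t) * (1 + - t) <= _); [nra|rewrite ler_wpM2l //; lra].
Qed.

(** Since [E <= 1], a relative error of the n-th root is also an absolute one. *)
Lemma root_of_ratio (R : realType) (n : nat) (C F E D c : R) :
  (0 < n)%N -> 0 < C -> 0 < F -> 0 < E <= 1 -> 0 <= D <= 2^-1 ->
  c <= E -> n%:R * ln E - n%:R * D <= ln C - ln F <= n%:R * ln E + n%:R * D ->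
  exists y : R, [/\ C = F * y ^+ n, c - D <= y & y <= E + 2 * D].
Proof.
move=> n0 C0 F0 /andP[E0 E1] /andP[D0 D1] cE /andP[lo up].
have n0' : 0 < n%:R :> R by rewrite ltr0n.
exists (expR ((ln C - ln F) / n%:R)); split.
- rewrite -expRM_natl mulrCA divff ?mulr1 ?gt_eqF // expRD expRN !lnK ?posrE //.
  by field; rewrite gt_eqF.
- have : ln E - D <= (ln C - ln F) / n%:R by rewrite ler_pdivlMr //; lra.
  rewrite -ler_expR expRD lnK ?posrE //; apply: le_trans.
  have : E * (1 + - D) <= E * expR (- D) by rewrite ler_pM2l // expR_ge1Dx.
  apply: le_trans.
  have : E * D <= D by rewrite ler_piMl.
  lra.
- have : (ln C - ln F) / n%:R <= ln E + D by rewrite ler_pdivrMr //; lra.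
  rewrite -ler_expR expRD lnK ?posrE // => /le_trans; apply.
  apply: le_trans (_ : E * (1 + 2 * D) <= _).
    by rewrite ler_pM2l // expR_le1D2 // D0.
  have : E * D <= D by rewrite ler_piMl.
  lra.
Qed.

Lemma ln_le (R : realType) (x : R) : 0 < x -> ln x <= x.
Proof.
move=> x0; rewrite -[X in ln X](subrK 1) addrC.
by apply: le_trans (le_ln1Dx _) _; lra.
Qed.

(** With [z = q^4], [W = C0 * q] and [n] about [q^12], both terms of [eta] have order [q^-3], and
    the overlap factor [W^2] turns this into order [1 / q]. In [D], the first two terms come from
    [eps] and [eta], and 160 leaves room for [theta = 1 / q] and the logarithms; [8 * C0 ^ 4 <= q]
    yields the size condition of the lower bound. *)
Lemma coprime_count_root (R : realType) (C0 n q : nat) :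
  (0 < C0)%N -> (0 < q)%N ->
  (forall i, (0 < i <= n)%N -> (omega2 n i <= C0 * q)%N) ->
  (q ^ 12 <= n)%N -> (n < q.+1 ^ 12)%N ->
  let D := (160 * C0 ^ 3 + 5 * C0 + 160)%N in
  (2 * D + 8 * C0 ^ 4 <= q)%N ->
  exists y : R, (coprime_perm_count n)%:R = n`!%:R * y ^+ n /\
    `|y - euler_product R| <= (4 + 2 * D)%N%:R / q%:R.
Proof.
move=> C00 q0 omW qn nq D Dq.
have C01 : 1 <= C0%:R :> R by rewrite ler1n.
have D160 : (160 <= D)%N by rewrite /D; lia.
have q2 : (1 < q)%N by lia.
have Q0 : 0 < q%:R :> R by rewrite ltr0n.
set X : R := q%:R^-1; have X0 : 0 < X by rewrite invr_gt0.
have X1 : X <= 2^-1 by rewrite lef_pV2 ?posrE // ler_nat.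
have QX : q%:R * X = 1 by rewrite divff // gt_eqF.
have DX : D%:R * X <= 2^-1.
  rewrite ler_pdivrMr //; have : (2 * D <= q)%N by lia.
  by rewrite -(ler_nat R) natrM; lra.
have DE : D%:R = 160 * C0%:R ^+ 3 + 5 * C0%:R + 160 :> R.
  by rewrite /D 2!natrD (natrM _ 160) natrX (natrM _ 5).
have n0 : (0 < n)%N by apply: leq_trans qn; rewrite expn_gt0 q0.
have N0 : 0 < n%:R :> R by rewrite ltr0n.
have NV k : (k <= 12)%N -> q%:R ^+ k / n%:R <= X ^+ (12 - k).
  move=> k12; rewrite ler_pdivrMr //.
  have e : q%:R ^+ k = X ^+ (12 - k) * q%:R ^+ 12.
    rewrite -{2}(subnK k12) exprD mulrA -exprMn [X * _]mulrC QX expr1n mul1r //.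
  by rewrite e ler_pM2l ?exprn_gt0 // -natrX ler_nat.
pose z := (q ^ 4)%N; pose W := (C0 * q)%N.
have zE : z%:R = q%:R ^+ 4 :> R by rewrite natrX.
have WE : W%:R = C0%:R * q%:R :> R by rewrite natrM.
have z1 : (1 < z)%N by rewrite /z -{1}(exp1n 4) ltn_exp2r.
have zn : (1 < z <= n)%N by rewrite z1 (leq_trans _ qn) // leq_pexp2l.
have W0 : (0 < W)%N by rewrite muln_gt0 C00.
have nW : (4 * W ^ 2 * (W ^ 2 + 1) <= n)%N.
  apply: leq_trans (_ : 8 * W ^ 4 <= _)%N.
    rewrite (_ : W ^ 4 = W ^ 2 * W ^ 2)%N; last by rewrite -expnD.
    have : (0 < W ^ 2)%N by rewrite expn_gt0 W0.
    by nia.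
  rewrite /W expnMn mulnA; apply: leq_trans (_ : q * q ^ 4 <= _)%N.
    by rewrite leq_mul2r; apply/orP; right; lia.
  by rewrite -expnS (leq_trans _ qn) // leq_pexp2l.
pose eta : R := W%:R / z%:R + 4 * z%:R ^+ 2 * W%:R / n%:R.
have X2le : X ^+ 2 <= X by rewrite expr2 ler_piMl //; lra.
have X3le : X ^+ 3 <= X by rewrite exprS ler_piMr ?exprn_ile1 //; lra.
have etaX : eta <= 5 * C0%:R * X ^+ 3.
  have e1 : W%:R / z%:R = C0%:R * X ^+ 3.
    by rewrite WE zE /X; field; rewrite gt_eqF.
  have e2 : 4 * z%:R ^+ 2 * W%:R / n%:R = 4 * C0%:R * (q%:R ^+ 9 / n%:R) :> R.
    by rewrite zE WE; ring.
  have : 4 * C0%:R * (q%:R ^+ 9 / n%:R) <= 4 * C0%:R * X ^+ 3.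
    by rewrite ler_wpM2l ?mulr_ge0 ?ler0n // NV.
  rewrite /eta e1 e2; lra.
pose eps : R := 32 * W%:R ^+ 2 * eta.
have epsX : eps <= 160 * C0%:R ^+ 3 * X.
  apply: le_trans (_ : 32 * W%:R ^+ 2 * (5 * C0%:R * X ^+ 3) <= _).
    by rewrite ler_wpM2l // mulr_ge0 // exprn_ge0.
  by rewrite WE le_eqVlt; apply/orP; left; apply/eqP; rewrite /X; field; rewrite gt_eqF.
have C3 : 0 < C0%:R ^+ 3 :> R by rewrite exprn_gt0 // ltr0n.
have C30 : 160 * C0%:R ^+ 3 * X <= D%:R * X.
  by rewrite ler_pM2r // DE; lra.
have eps2 : eps <= 2^-1 by lra.
have [Cpos low] := ln_count_lower zn omW nW eps2.
have th : 0 < X < 1 by rewrite X0; lra.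
have CX : C0%:R * X <= D%:R * X by rewrite ler_pM2r // DE; lra.
have eta1 : eta <= 1.
  have : 5 * C0%:R * X ^+ 3 <= 5 * C0%:R * X by rewrite ler_wpM2l ?mulr_ge0.
  have : 5 * C0%:R * X <= D%:R * X by rewrite ler_pM2r // DE; lra.
  lra.
have up := ln_count_upper zn th omW eta1 Cpos.
have M3 : 2 * z%:R ^+ 2 / n%:R / X <= 2 * X ^+ 3.
  have -> : 2 * z%:R ^+ 2 / n%:R / X = 2 * (q%:R ^+ 9 / n%:R) :> R.
    by rewrite zE /X invrK; ring.
  by rewrite ler_pM2l // NV.
have lnz : ln z%:R <= ln n%:R :> R.
  have /andP[_ zn'] := zn; have z0 := ltnW z1.
  by rewrite ler_ln ?posrE ?ltr0n // ler_nat.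
have lnn : ln n%:R <= n%:R * (24 * X) :> R.
  have l1 : ln n%:R <= 12 * (2 * q%:R) :> R.
    apply: le_trans (_ : ln ((2 * q%:R) ^+ 12) <= _).
      rewrite ler_ln ?posrE ?exprn_gt0 ?mulr_gt0 // -natrM -natrX ler_nat.
      apply: leq_trans (ltnW nq) _; rewrite leq_exp2r //.
      by rewrite mul2n -addnn -addn1 leq_add2l.
    by rewrite lnXn ?mulr_gt0 // -[ln (2 * q%:R) *+ _]mulr_natl ler_pM2l // ln_le // mulr_gt0.
  apply: le_trans l1 _.
  have : q%:R ^+ 1 / n%:R <= X by apply: le_trans (NV 1%N _) _; rewrite // exprS ler_piMr ?exprn_ile1 //; lra.
  by rewrite expr1 ler_pdivrMr //; lra.
have lnn0 : 0 <= ln n%:R :> R by rewrite ln_ge0 // ler1n.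
have n1X : 1 <= n%:R * X.
  have : q%:R ^+ 1 <= n%:R :> R.
    by rewrite -natrX ler_nat (leq_trans _ qn) // leq_pexp2l.
  by rewrite expr1 -(ler_pM2r X0 q%:R) QX.
have /andP[f1 f2] := ln_fact_itv R n0.
have /andP[c1 c2] := euler_product_itv R z1.
have F0 : 0 < n`!%:R :> R by rewrite ltr0n fact_gt0.
have DX0 : 0 <= D%:R * X by rewrite mulr_ge0 // ltW.
have bounds : n%:R * ln (euler_partial R z.+1) - n%:R * (D%:R * X) <=
     ln (coprime_perm_count n)%:R - ln n`!%:R <=
     n%:R * ln (euler_partial R z.+1) + n%:R * (D%:R * X).
  have nX0 : 0 < n%:R * X by rewrite mulr_gt0.
  have E1 : n%:R * (D%:R * X) = 160 * (C0%:R ^+ 3 * (n%:R * X)) +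
      5 * (C0%:R * (n%:R * X)) + 160 * (n%:R * X) by rewrite DE; ring.
  have C3X : 0 <= C0%:R ^+ 3 * (n%:R * X) by rewrite mulr_ge0 // ltW.
  have CnX : 0 <= C0%:R * (n%:R * X) by rewrite mulr_ge0 // ltW.
  have ne : n%:R * eps <= 160 * (C0%:R ^+ 3 * (n%:R * X)).
    apply: le_trans (_ : n%:R * (160 * C0%:R ^+ 3 * X) <= _); first by rewrite ler_pM2l.
    by rewrite le_eqVlt; apply/orP; left; apply/eqP; ring.
  have nerr : n%:R * (eta + 2 * z%:R ^+ 2 / n%:R / X + 3 * X) <=
      5 * (C0%:R * (n%:R * X)) + 5 * (n%:R * X).
    apply: le_trans (_ : n%:R * (5 * C0%:R * X + 5 * X) <= _); last first.
      by rewrite le_eqVlt; apply/orP; left; apply/eqP; ring.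
    rewrite ler_pM2l //.
    have : 5 * C0%:R * X ^+ 3 <= 5 * C0%:R * X by rewrite ler_wpM2l ?mulr_ge0.
    lra.
  rewrite E1; move: low up; rewrite -/eta -/eps => low up.
  apply/andP; split.
    lra.
  lra.
have DI : 0 <= D%:R * X <= 2^-1 by rewrite DX0.
have [y [yE y1 y2]] := root_of_ratio n0 Cpos F0 (euler_partial_itv R z.+1) DI c1 bounds.
exists y; split => //.
have z4 : 4 / z%:R <= 4 * X.
  have z0 := ltnW z1; rewrite ler_pM2l // lef_pV2 ?posrE ?ltr0n // ler_nat.
  by rewrite -{1}[q]expn1 leq_pexp2l.
rewrite natrD natrM mulrDl -mulrA -/X ler_norml; apply/andP; split; lra.
Qed.

Theorem theorem1p2 (R : realType) :
  exists (c : R) (n0 : nat), 0 < c /\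
    forall n : nat, (n0 <= n)%N ->
      exists eps : R,
        `|eps| <= expR (- c * Num.sqrt (ln n%:R * ln (ln n%:R))) /\
        (coprime_perm_count n)%:R = (n`!)%:R * (euler_product R + eps) ^+ n.
Proof.
have [C0 C00 omW] := @omega2_root 12 isT.
pose D := (160 * C0 ^ 3 + 5 * C0 + 160)%N.
pose q0 := (2 * D + 8 * C0 ^ 4)%N.
pose A := (4 + 2 * D)%N.
(* The error is [A / q] with [q] about n^(1/12). One factor n^(1/24) absorbs the constant, whence
   [(2 * A) ^ 24], and the other gives the bound n^(-1/24). *)
exists 24^-1, (q0 ^ 12 + (2 * A) ^ 24 + 1)%N; split; first by rewrite invr_gt0.
move=> n nbig.
have n0 : (0 < n)%N by apply: leq_trans nbig; rewrite addn1.
have [q [q1 qn nq]] := @root_floor 12 n isT n0.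
have qq0 : (q0 <= q)%N.
  rewrite -ltnS -(@ltn_exp2r _ _ 12) //; apply: leq_ltn_trans nq.
  by apply: leq_trans nbig; rewrite -addnA leq_addr.
have [y [yE yc]] := @coprime_count_root R C0 n q C00 q1
  (fun i iN => omW n i q iN q1 nq) qn nq qq0.
exists (y - euler_product R); split; last by rewrite addrC subrK.
apply: le_trans yc _; rewrite -/D -/A.
have N0 : 0 < n%:R :> R by rewrite ltr0n.
have Q0 : 0 < q%:R :> R by rewrite ltr0n.
have L0 : 0 <= ln n%:R :> R by rewrite ln_ge0 // ler1n.
pose t : R := expR (ln n%:R / 24).
have t0 : 0 < t by exact: expR_gt0.
have t24 : t ^+ 24 = n%:R.
  by rewrite -expRM_natl mulrCA divff ?mulr1 ?lnK.
have At : 2 * A%:R <= t.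
  rewrite -(@ler_pXn2r _ 24) ?nnegrE ?(ltW t0) ?mulr_ge0 //.
  rewrite t24 -natrM -natrX ler_nat; apply: leq_trans nbig.
  by rewrite addnAC leq_addl.
have AtQ : A%:R * t <= q%:R.
  rewrite -(ler_pM2l (_ : 0 < 2)) //.
  rewrite -(@ler_pXn2r _ 12) ?nnegrE ?mulr_ge0 ?(ltW t0) ?(ltW Q0) //.
  apply: le_trans (_ : n%:R <= _); last first.
    rewrite -natrM -natrX ler_nat; apply: leq_trans (ltnW nq) _.
    by rewrite leq_exp2r // mul2n -addnn -addn1 leq_add2l.
  rewrite mulrA exprMn -t24 (exprD t 12 12) ler_pM2r ?exprn_gt0 //.
  by rewrite ler_pXn2r ?nnegrE ?(ltW t0) // mulr_ge0.
apply: le_trans (_ : t^-1 <= _).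
  by rewrite ler_pdivrMr // mulrC ler_pdivlMr.
rewrite /t -expRN ler_expR mulNr lerN2 mulrC ler_pM2r ?invr_gt0 //.
(* If [ln n <= 1], then [ln (ln n) <= 0] and the square root takes its value 0 on nonpositive
   numbers; otherwise [ln (ln n) <= ln n]. *)
have [l1|l1] := leP (ln n%:R : R) 1.
  by rewrite ler0_sqrtr // mulr_ge0_le0 // ln_le0.
rewrite -[leRHS]ger0_norm // -sqrtr_sqr ler_wsqrtr // expr2 ler_wpM2l //.
by rewrite ln_le // (lt_trans ltr01).
Qed.
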